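(* Let $\Omega\subset\mathbb{R}^d$ be a bounded open set with Lipschitz boundary and let $|\cdot|_*$ be a norm on $\mathbb{R}^d$. Let $K$ be a kernel on $\mathbb{R}^d$ such that: (i) $K\notin L^1(\mathbb{R}^d)$; (ii) there is $c_0\in(0,1]$ such that $|x|_*\le|y|_*$ implies $K(x)\ge c_0K(y)$; (iii) there are positive constants $D$ and $C_D$ such that $|y|_*=2|x|_*$ and $|x|_*\le D$ imply $K(x)\le C_DK(y)$; (iv) $\int_{\mathbb{R}^d}K(z)\min\{1,|z|_2\}\,dz<+\infty$. Assume that for some $q\in[1,+\infty)$ there is a positive constant $C_1$ such that $\mathcal{P}_{K^*}(B^m)\ge m^{1/q}/C_1$ for every $m>0$. Then there exists a positive constant $C$ such that $$\min\{|E\cap\Omega|,|\Omega\setminus E|\}^{1/q}\le C\,\mathcal{P}_K(E;\Omega)\qquad\text{for every measurable }E\subseteq\mathbb{R}^d.$$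
   Context: Here $d\ge1$, $|\cdot|_2$ is the Euclidean norm and $|A|$ denotes the Lebesgue measure of a measurable set $A$. A kernel is a measurable function $K:\mathbb{R}^d\to[0,+\infty]$ that is not a.e. equal to $0$. For measurable $E,\Omega\subset\mathbb{R}^d$, with $\Omega^c=\mathbb{R}^d\setminus\Omega$, the $K$-perimeter of $E$ relative to $\Omega$ is $$\mathcal{P}_K(E;\Omega):=\Bigl(\tfrac12\int_{\Omega\times\Omega}+\int_{\Omega\times\Omega^c}\Bigr)|\mathbf{1}_E(x)-\mathbf{1}_E(y)|K(x-y)\,dx\,dy,$$ and for any kernel $J$, $\mathcal{P}_J(E):=\mathcal{P}_J(E;\mathbb{R}^d)=\frac12\int_{\mathbb{R}^d}\int_{\mathbb{R}^d}|\mathbf{1}_E(x)-\mathbf{1}_E(y)|J(x-y)\,dx\,dy$. For $m>0$, $B^m$ is the open Euclidean ball centred at the origin with Lebesgue measure $m$. For a measurable set $A$ with finite measure, $A^*:=B^{|A|}$ (with $A^*=\emptyset$ if $|A|=0$). The symmetric-decreasing rearrangement of $K$ is $K^*(x):=\int_0^{+\infty}\mathbf{1}_{\{K>t\}^*}(x)\,dt$. *)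

(* Defs.v *)
From HB Require Import structures.
From mathcomp Require Import all_boot all_order all_algebra.
From mathcomp Require Import all_classical all_reals all_analysis.
From mathcomp Require Import measurable_realfun.
Import Order.TTheory GRing.Theory Num.Theory numFieldNormedType.Exports.

Set Implicit Arguments.
Unset Strict Implicit.
Unset Printing Implicit Defensive.

Local Open Scope classical_set_scope.
Local Open Scope ring_scope.

Section lebesgue_tuple.
Context (R : realType).
Local Notation mR := (measurableTypeR R).

Definition tuple_cons n (p : mR * n.-tuple mR) : n.+1.-tuple mR :=
  [tuple of p.1 :: p.2].

Lemma measurable_tuple_cons n :
  measurable_fun [set: mR * n.-tuple mR] (@tuple_cons n).
Proof. exact: measurable_cons. Qed.

Section lebesgue_cons.
Context n (m : {sigma_finite_measure set (n.-tuple mR) -> \bar R}).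

Definition lebesgue_cons : set (n.+1.-tuple mR) -> \bar R :=
  pushforward (@lebesgue_measure R \x m)%E (@tuple_cons n).

Let nu : {measure set (n.+1.-tuple mR) -> \bar R} :=
  measure_function_pushforward__canonical__measure_function_Measure
    (@lebesgue_measure R \x m)%E (@measurable_tuple_cons n).

Let lebesgue_cons0 : lebesgue_cons set0 = 0%E.
Proof. exact: (measure0 nu). Qed.

Let lebesgue_cons_ge0 A : (0 <= lebesgue_cons A)%E.
Proof. exact: (measure_ge0 nu). Qed.

Let lebesgue_cons_sigma_additive : semi_sigma_additive lebesgue_cons.
Proof. exact: (@measure_semi_sigma_additive _ _ _ nu). Qed.

HB.instance Definition _ := isMeasure.Build _ _ _ lebesgue_cons
  lebesgue_cons0 lebesgue_cons_ge0 lebesgue_cons_sigma_additive.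

Let lebesgue_cons_sigma_finite : sigma_finite setT lebesgue_cons.
Proof.
have /sigma_finiteP[F [TF ndF Foo]] := sigma_finiteT (@lebesgue_measure R).
have /sigma_finiteP[G [TG ndG Goo]] := sigma_finiteT m.
exists (fun k => (@thead n mR) @^-1` F k `&`
                 (fun t : n.+1.-tuple mR => [tuple of behead t]) @^-1` G k).
  apply/esym; rewrite -subTset => t _.
  have [i _ Fi] : (\bigcup_i F i) (thead t) by rewrite -TF.
  have [j _ Gj] : (\bigcup_i G i) [tuple of behead t] by rewrite -TG.
  exists (maxn i j) => //; split.
    have /subsetPset := ndF _ _ (leq_maxl i j); exact.
  have /subsetPset := ndG _ _ (leq_maxr i j); exact.
move=> k; have [mF Fk] := Foo k; have [mG Gk] := Goo k; split.
  apply: measurableI; rewrite -[X in measurable X]setTI.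
    exact: (@measurable_tnth _ mR n.+1 ord0).
  exact: (@measurable_behead _ mR n).
rewrite /lebesgue_cons /pushforward.
rewrite (_ : _ @^-1` _ = F k `*` G k); last first.
  have tK x (t : n.-tuple mR) : [tuple of behead (tuple_cons (x, t))] = t.
    exact: val_inj.
  by apply/seteqP; split => -[x t] [] Fx /=; rewrite tK => Gt; split.
by rewrite product_measure1E// lte_mul_pinfty// ge0_fin_numE.
Qed.

HB.instance Definition _ := @Measure_isSigmaFinite.Build _ _ _ lebesgue_cons
  lebesgue_cons_sigma_finite.

End lebesgue_cons.

Fixpoint lebesgue_tuple n : {sigma_finite_measure set (n.-tuple mR) -> \bar R} :=
  match n with
  | 0 => \d_([tuple] : 0.-tuple mR)
  | n'.+1 => lebesgue_cons (lebesgue_tuple n')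
  end.

End lebesgue_tuple.

Section lebesgue_outer.
Context (R : realType) (d : nat).

(* Lebesgue outer measure on R^d: the outer extension of the d-fold product of
   the one-dimensional Lebesgue measure. Its Caratheodory sets are all the
   Lebesgue measurable sets, not only the Borel ones. *)
Definition lebesgue_outer (A : set 'rV[R]_d) : \bar R :=
  ((lebesgue_tuple R d)^*)%mu [set t | A (\row_i tnth t i)].

Let lebesgue_outer0 : lebesgue_outer set0 = 0%E.
Proof. exact: outer_measure0. Qed.

Let lebesgue_outer_ge0 A : (0 <= lebesgue_outer A)%E.
Proof. exact: outer_measure_ge0. Qed.

Let le_lebesgue_outer : {homo lebesgue_outer : A B / A `<=` B >-> (A <= B)%E}.
Proof. by move=> A B AB; apply: le_outer_measure => t; exact: AB. Qed.

Let lebesgue_outer_sigma_subadditive : sigma_subadditive lebesgue_outer.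
Proof. by move=> A; exact: outer_measure_sigma_subadditive. Qed.

HB.instance Definition _ := isOuterMeasure.Build R 'rV[R]_d lebesgue_outer
  lebesgue_outer0 lebesgue_outer_ge0 le_lebesgue_outer
  lebesgue_outer_sigma_subadditive.

End lebesgue_outer.

Notation lebesgue_type R d := (caratheodory_type (@lebesgue_outer R d)).

Section lebesgue_measure_rV.
Context {R : realType} {d : nat}.

Definition lebesgue_rV : set (lebesgue_type R d) -> \bar R :=
  @lebesgue_outer R d.

Let lebesgue_rV0 : lebesgue_rV set0 = 0%E.
Proof. exact: outer_measure0. Qed.

Let lebesgue_rV_ge0 A : (0 <= lebesgue_rV A)%E.
Proof. exact: outer_measure_ge0. Qed.

Let lebesgue_rV_sigma_additive : semi_sigma_additive lebesgue_rV.
Proof. exact: caratheodory_measure_sigma_additive. Qed.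

HB.instance Definition _ := isMeasure.Build _ _ _ lebesgue_rV
  lebesgue_rV0 lebesgue_rV_ge0 lebesgue_rV_sigma_additive.

End lebesgue_measure_rV.

Section geometry.
Context {R : realType} {d : nat}.
Implicit Types (x y : 'rV[R]_d).

Definition enorm x : R := Num.sqrt (\sum_(i < d) x ord0 i ^+ 2).

Definition is_norm (N : 'rV[R]_d -> R) : Prop :=
  [/\ forall x, 0 <= N x,
      forall x, N x = 0 -> x = 0,
      forall (a : R) x, N (a *: x) = `|a| * N x &
      forall x y, N (x + y) <= N x + N y].

(* Near each boundary point, after an isometric change of coordinates
   y |-> y *m Q, the set is the strict epigraph, in the direction of the j-th
   coordinate, of a Lipschitz function of the d.-1 other coordinates. *)
Definition lipschitz_boundary (Omega : set 'rV[R]_d) : Prop :=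
  forall x, (closure Omega `\` interior Omega) x ->
  exists (Q : 'M[R]_d) (j : 'I_d) (g : 'rV[R]_(d.-1) -> R) (r : R),
    [/\ Q *m Q^T = 1%:M, lipschitz g, 0 < r &
        forall y, enorm (y - x) < r ->
          Omega y <-> g (col' j (y *m Q)) < (y *m Q) ord0 j].

End geometry.

Section rearrangement.
Context {R : realType} {d : nat}.
Implicit Types (A : set 'rV[R]_d) (K : 'rV[R]_d -> \bar R).

Definition eball (r : R) : set 'rV[R]_d := [set x | enorm x < r].

(* The open ball B^m; for m = 0 the radius is 0 and the ball is empty. *)
Definition ball_of_measure (m : R) : set 'rV[R]_d :=
  eball (xget 0 [set r | 0 <= r /\ lebesgue_rV (eball r) = m%:E]).

(* Only meaningful when A has finite measure: fine +oo = 0, so a set of infinite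
   measure is sent to the empty set. *)
Definition set_rearrangement A : set 'rV[R]_d :=
  ball_of_measure (fine (lebesgue_rV A)).

Definition rearrangement K : 'rV[R]_d -> \bar R := fun x =>
  (\int[@lebesgue_measure R]_(t in `]0%R, +oo[)
     (\1_(set_rearrangement [set y | ((t : R)%:E < K y)%E]) x)%:E)%E.

End rearrangement.

Section perimeter.
Context {R : realType} {d : nat}.
Implicit Types (E Omega A B : set 'rV[R]_d) (K : 'rV[R]_d -> \bar R).

Definition is_kernel K : Prop :=
  [/\ measurable_fun [set: lebesgue_type R d] K,
      forall x, (0 <= K x)%E &
      ~ {ae lebesgue_rV, forall x, K x = 0%E}].

(* In the iterated integral x ranges over the first set and y over the second
   one; K is not assumed to be even, so the order matters. *)
Definition interaction K E A B : \bar R :=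
  (\int[lebesgue_rV]_(x in A) \int[lebesgue_rV]_(y in B)
     (`|\1_E x - \1_E y|%:E * K (x - y)%R))%E.

Definition perimeter_in K E Omega : \bar R :=
  (2^-1%:E * interaction K E Omega Omega
   + interaction K E Omega (~` Omega))%E.

Definition perimeter K E : \bar R := perimeter_in K E setT.

End perimeter.

(* Main.v *)
Require Import Defs.
From HB Require Import structures.
From mathcomp Require Import all_boot all_order all_algebra.
From mathcomp Require Import all_classical all_reals all_analysis.
From mathcomp Require Import measurable_realfun.
From mathcomp Require Import ring lra.
Import Order.TTheory GRing.Theory Num.Theory numFieldNormedType.Exports.

Local Open Scope classical_set_scope.
Local Open Scope ring_scope.

(** The kernel is comparable, up to the factor c0, to a function of N z
    decreasing in N z, so it is a superposition of indicators of N-balls, one for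
    each dyadic level.  Both sides of the inequality are compared level by level
    with a_n * min(1, R_n / r), where a_n is the measure of the superlevel set,
    R_n the radius of the ball of the same measure and r^d ~ m.

    Upper bound for the rearranged kernel: |B \Delta (B + z)| <= C m min(1, |z|/r)
    for a ball B of radius r.

    Lower bound in Omega: near each point of its closure, Omega is stable under
    small translations by the vectors of some cube C.  Translating a piece of E of
    measure comparable to m by s w, w in C, moves at least half of it out of E on
    average when s >> r.  A translation by n s w is a succession of n translations
    by s w inside Omega, so a translation by s w separates at least 1/n of that
    mass; taking n ~ r / s gives m min(1, s/r).

    The levels at which the superlevel sets are large, and the sets E for which m
    is not small, are dealt with by a positive lower bound of K on Omega - Omega.
    It exists because the isoperimetric hypothesis excludes a compactly supported
    K: letting m tend to infinity would force d/q <= d - 1, and letting m tend to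
    0 would force d/q > d - 1. *)

(** Two points shape the argument. The interaction is therefore only compared, by monotonicity of
    the integral of nonnegative functions, with series of indicators of measurable sets of pairs,
    and the part of [E] in [Omega] (or its complement there) is replaced by a Borel set that differs
    from it by a null set.

    Second, the translation argument only reaches s <= 1. A threshold b is fixed such that K > b
    forces N <= 1. For a ball of measure m, the levels below b contribute at most S m to the upper
    bound, with S independent of m: a geometric sum when R_n < 1, the moment of [K] when R_n >= 1. A
    multiple of m is in turn bounded by the interaction, through the lower bound of [K] on Omega -
    Omega. *)

Set Implicit Arguments.
Unset Strict Implicit.
Unset Printing Implicit Defensive.


(** * Affine changes of variables and Borel hulls *)

Section affine_real.
Context (R : realType).
Local Notation mR := (measurableTypeR R).
Local Notation leb := (@lebesgue_measure R).

Lemma measurable_affine (a v : R) :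
  measurable_fun setT ((fun x => a * x + v) : mR -> mR).
Proof. by apply: measurable_funD => //; exact: mulrl_measurable. Qed.

(** The pushforward multiplied by [a] agrees with Lebesgue measure on the intervals []p, q]], and
    uniqueness of the extension identifies the two measures. *)
Lemma lebesgue_measure_affine (a v : R) (A : set mR) : 0 < a -> measurable A ->
  pushforward leb ((fun x => a * x + v) : mR -> mR) A = ((a^-1)%:E * leb A)%E.
Proof.
move=> a0 mA.
have ai0 : 0 <= a by exact: ltW.
pose nu : {measure set mR -> \bar R} :=
  measure_function_pushforward__canonical__measure_function_Measure
    leb (measurable_affine a v).
pose nu' := mscale (NngNum ai0) nu.
suff H B : measurable B -> leb B = nu' B.
  by rewrite (H _ mA) /nu' /mscale /= muleA -EFinM mulVf ?gt_eqF// mul1e.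
move=> mB; apply: (@lebesgue_measure_unique _ nu') => // X [[p q]] _ <-.
rewrite [RHS](_ : _ =
    a%:E * leb ((fun x : R => a * x + v)%R @^-1` `]p, q]%classic))%E //.
rewrite (_ : _ @^-1` _
   = `](p - v) / a, (q - v) / a]%classic); last first.
  apply/seteqP; split => x /=; rewrite !in_itv/= => /andP[h1 h2];
   apply/andP; split.
  - by rewrite ltr_pdivrMr// ltrBlDr mulrC.
  - by rewrite ler_pdivlMr// lerBrDr mulrC.
  - by move: h1; rewrite ltr_pdivrMr// ltrBlDr mulrC.
  - by move: h2; rewrite ler_pdivlMr// lerBrDr mulrC.
rewrite !lebesgue_measure_itv/= !lte_fin.
have -> : ((p - v) / a < (q - v) / a) = (p < q).
  by rewrite ltr_pM2r ?invr_gt0// ltrD2r.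
case: ifP => _; last by rewrite mule0.
by rewrite -!EFinD -EFinM; congr EFin; field; rewrite gt_eqF.
Qed.

Lemma ge0_integral_affine (a v : R) (f : mR -> \bar R) : 0 < a ->
  measurable_fun setT f -> (forall x, 0 <= f x)%E ->
  (\int[leb]_x f (a * x + v)%R = (a^-1)%:E * \int[leb]_x f x)%E.
Proof.
move=> a0 mf f0.
have ai0 : 0 <= a^-1 by rewrite invr_ge0 ltW.
have -> : (\int[leb]_x f (a * x + v)%R)%E =
    (\int[pushforward leb ((fun x => a * x + v)%R : mR -> mR)]_x f x)%E.
  rewrite ge0_integral_pushforward //; exact: measurable_affine.
rewrite -[X in (X%:E * _)%E]/((NngNum ai0)%:num) -ge0_integral_mscale//.
pose nu : {measure set mR -> \bar R} :=
  measure_function_pushforward__canonical__measure_function_Measure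
    leb (measurable_affine a v).
apply: (@eq_measure_integral _ _ _ _ (mscale (NngNum ai0) leb) nu) => A mA _.
by rewrite /mscale /=; exact: lebesgue_measure_affine.
Qed.

End affine_real.

Section affine_tuple.
Context (R : realType).
Local Notation mR := (measurableTypeR R).
Local Notation leb := (@lebesgue_measure R).

Definition tuple_affine n (a : R) (v : n.-tuple mR) (t : n.-tuple mR) :
    n.-tuple mR :=
  [tuple a * tnth t i + tnth v i | i < n].

Lemma measurable_tuple_affine n a (v : n.-tuple mR) :
  measurable_fun setT (tuple_affine a v).
Proof.
apply/measurable_fun_tnthP => i.
rewrite (_ : _ \o _ = (fun x : mR => a * x + tnth v i : mR) \o (@tnth n mR ^~ i)).
  apply: measurableT_comp; first exact: measurable_affine.
  exact: measurable_tnth.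
by apply/funext => t /=; rewrite tnth_mktuple.
Qed.

(** Induction along [tuple_cons]: the induction hypothesis treats the sections, and the
    one-dimensional change of variables in the first coordinate supplies the last factor [a^-1]. *)
Lemma lebesgue_tuple_affine n a (v : n.-tuple mR) (A : set (n.-tuple mR)) :
  0 < a -> measurable A ->
  lebesgue_tuple R n (tuple_affine a v @^-1` A) =
    ((a^-1 ^+ n)%:E * lebesgue_tuple R n A)%E.
Proof.
move=> a0; elim: n v A => [|n IH] v A mA.
  rewrite expr0 mul1e /=; congr (\d_ _ _).
  by apply/seteqP; split => t /=; rewrite (tuple0 (tuple_affine _ _ _)) (tuple0 t).
have mcA : measurable ((@tuple_cons R n) @^-1` A).
  by rewrite -[X in measurable X]setTI; exact: measurable_tuple_cons.
pose h (y : mR) := lebesgue_tuple R n (xsection ((@tuple_cons R n) @^-1` A) y).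
have mh : measurable_fun setT h by exact: measurable_fun_xsection.
transitivity (\int[leb]_x ((a^-1 ^+ n)%:E * h (a * x + thead v)%R))%E.
  rewrite /= /lebesgue_cons /pushforward /product_measure1.
  apply: eq_integral => x _ /=.
  rewrite /h -(IH [tuple of behead v]); last exact: measurable_xsection.
  congr (lebesgue_tuple R n _).
  have E t : tuple_affine a v (tuple_cons (x, t)) =
     tuple_cons (a * x + thead v, tuple_affine a [tuple of behead v] t).
    apply: eq_from_tnth => i; rewrite tnth_mktuple.
    case: (unliftP ord0 i) => [j ->|->]; rewrite ?tnth0// !tnthS tnth_mktuple.
    by rewrite [in LHS](tuple_eta v) tnthS.
  by apply/seteqP; split => t /=; rewrite /xsection /= !inE /= E.
rewrite ge0_integralZl//; last 2 first.
- by apply: (measurableT_comp mh); exact: measurable_affine.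
- by rewrite lee_fin exprn_ge0// invr_ge0 ltW.
by rewrite ge0_integral_affine// exprSr EFinM muleA.
Qed.

Lemma measurable_tuple_cube n (B : set mR) : measurable B ->
  measurable [set t : n.-tuple mR | forall i, B (tnth t i)].
Proof.
move=> mB; have -> : [set t : n.-tuple mR | forall i, B (tnth t i)] =
   \bigcap_(i in [set: 'I_n]) ((@tnth n mR ^~ i) @^-1` B).
  by apply/seteqP; split => t /= H i; [move=> _; exact: H | exact: H].
apply: fin_bigcap_measurable => // i _.
by rewrite -[X in measurable X]setTI; exact: measurable_tnth.
Qed.

Lemma lebesgue_tuple_cube n (B : set mR) : measurable B ->
  lebesgue_tuple R n [set t | forall i, B (tnth t i)] = (leb B ^+ n)%E.
Proof.
move=> mB; elim: n => [|n IH].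
  by rewrite /= diracE mem_set// => -[].
rewrite /= /lebesgue_cons /pushforward.
rewrite (_ : _ @^-1` _ =
    B `*` [set t : n.-tuple mR | forall i, B (tnth t i)]); last first.
  apply/seteqP; split => -[x t] /=.
    move=> H; split; first by have := H ord0; rewrite tnth0.
    by move=> i; have := H (lift ord0 i); rewrite tnthS.
  move=> [Bx Bt] i.
  by case: (unliftP ord0 i) => [j ->|->]; rewrite ?tnthS ?tnth0.
rewrite product_measure1E//; last exact: measurable_tuple_cube.
by rewrite IH; exact/esym/expeS.
Qed.

End affine_tuple.

Section outer_affine.
Context {R : realType} {d : nat}.
Local Notation mR := (measurableTypeR R).
Local Notation T := (lebesgue_type R d).
Local Notation mu := (@lebesgue_rV R d).
Implicit Types (A B : set 'rV[R]_d).

Definition row_of (t : d.-tuple mR) : 'rV[R]_d := \row_i tnth t i.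

(** [T] carries the Caratheodory sigma-algebra. The preimage of a Lebesgue measurable set under (x,
    y) |-> a x + b y need not lie in the product sigma-algebra of [T * T]; for the sets singled out
    here it does, by [measurable_affine_prod]. *)
Definition borel_rV A := measurable (row_of @^-1` A).

Lemma row_ofK (x : 'rV[R]_d) : row_of [tuple (x ord0 i : mR) | i < d] = x.
Proof. by apply/rowP => i; rewrite !mxE tnth_mktuple. Qed.

Lemma borel_measurable A : borel_rV A -> measurable (A : set T).
Proof.
move=> mA.
suff : (@lebesgue_outer R d).-caratheodory A by [].
by move=> X; exact: (caratheodory_measurable_mu_ext _ mA (row_of @^-1` X)).
Qed.

Lemma borel_outer A : borel_rV A -> mu A = lebesgue_tuple R d (row_of @^-1` A).
Proof. by move=> mA; exact: measurable_mu_extE. Qed.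

Lemma measurable_preimage_borel d' (X : measurableType d') (f : X -> 'rV[R]_d) A :
  (forall i, measurable_fun setT (fun x => f x ord0 i : mR)) ->
  borel_rV A -> measurable (f @^-1` A).
Proof.
move=> mf mA; pose g x := [tuple (f x ord0 i : mR) | i < d].
have -> : f @^-1` A = g @^-1` (row_of @^-1` A).
  by apply/seteqP; split => x /=; rewrite row_ofK.
rewrite -[X in measurable X]setTI.
have mg : measurable_fun setT g.
  apply/measurable_fun_tnthP => i.
  by rewrite (_ : _ \o _ = (fun x => f x ord0 i : mR)) //; apply/funext => x /=;
    rewrite tnth_mktuple.
exact: mg.
Qed.

Lemma borel_coord (i : 'I_d) (B : set mR) : measurable B ->
  borel_rV [set x | B (x ord0 i)].
Proof.
move=> mB; rewrite /borel_rV.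
rewrite (_ : _ @^-1` _ = (@tnth d mR ^~ i) @^-1` B).
  by rewrite -[X in measurable X]setTI; exact: measurable_tnth.
by apply/seteqP; split => t /=; rewrite mxE.
Qed.

Lemma measurable_coord (i : 'I_d) :
  measurable_fun setT (fun x : T => (x : 'rV[R]_d) ord0 i : mR).
Proof.
by move=> _ B mB; rewrite setTI; apply: borel_measurable; exact: borel_coord.
Qed.

Definition cube (z : 'rV[R]_d) (r : R) : set 'rV[R]_d :=
  [set x | forall i, `|x ord0 i - z ord0 i| < r].

Lemma borel_cube z r : borel_rV (cube z r).
Proof.
rewrite /borel_rV (_ : _ @^-1` _ =
   \bigcap_(i in [set: 'I_d])
     (row_of @^-1` [set x | [set y : mR | `|y - z ord0 i| < r] (x ord0 i)])).
  apply: fin_bigcap_measurable => // i _; apply: borel_coord.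
  rewrite (_ : [set _ | _] = `](z ord0 i - r), (z ord0 i + r)[%classic) //.
  by apply/seteqP; split => y /=; rewrite in_itv/= ltr_distl.
by apply/seteqP; split => t /= H i; [move=> _; exact: H | exact: H].
Qed.

Lemma ball_cube (z : 'rV[R]_d) (r : R) : 0 < r -> ball z r = cube z r.
Proof.
move=> r0; apply/seteqP; split => x.
  by move=> [_ H] i; rewrite distrC; exact: H.
by move=> H; split => // i j; rewrite /ball/= ord1 distrC; exact: H.
Qed.

Lemma borel_open A : open A -> borel_rV A.
Proof.
move=> oA.
pose I := ('rV[rat]_d * nat)%type.
pose c (p : I) : 'rV[R]_d := map_mx ratr p.1.
pose P := [set p : I | cube (c p) (p.2.+1%:R^-1) `<=` A].
have -> : A = \bigcup_(p in P) cube (c p) (p.2.+1%:R^-1).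
  apply/seteqP; split => [x Ax|x [p Pp]]; last exact: Pp.
  have /nbhs_ballP[e /= e0 He] : nbhs x A by exact: open_nbhs_nbhs.
  have [n n_gt] : exists n : nat, n.+1%:R^-1 < e / 2.
    have e2 : 0 < e / 2 by rewrite divr_gt0.
    have [n _ Hn] := near_infty_natSinv_lt (PosNum e2).
    by exists n; apply: Hn => /=.
  have /choice[q Hq] : forall i : 'I_d, exists q : rat,
      `|x ord0 i - ratr q| < n.+1%:R^-1 :> R.
    move=> i.
    have n0 : (0 : R) < n.+1%:R^-1 by rewrite invr_gt0.
    have := @rat_in_itvoo R (x ord0 i - n.+1%:R^-1) (x ord0 i + n.+1%:R^-1).
    case; first by rewrite ltrBlDr -addrA ltrDl addr_gt0.
    move=> q; rewrite in_itv/= => /andP[q1 q2]; exists q.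
    by rewrite distrC ltr_distl q1 q2.
  exists (\row_i q i, n); last first.
    by move=> i /=; rewrite !mxE; exact: Hq.
  move=> y Hy; apply: He; rewrite ball_cube// => i.
  rewrite -(subrK (c (\row_i q i, n) ord0 i) (y ord0 i)) -addrA.
  rewrite (le_lt_trans (ler_normD _ _))// (splitr e) ltrD//.
    by apply: lt_trans n_gt; exact: Hy.
  apply: lt_trans n_gt; rewrite distrC /c /= !mxE; exact: Hq.
rewrite bigcup_mkcond /borel_rV preimage_bigcup.
apply: countable_bigcupT_measurable; first exact: countableP.
move=> p.
by case: ifP => // _; [exact: borel_cube | rewrite preimage_set0].
Qed.

(** A cover by measurable sets of tuples pulls back to a cover of the preimage, and each member has
    its measure multiplied by a^-d. Equality follows below by applying this to the inverse map. *)
Lemma lebesgue_outer_affine_le (a : R) (v : 'rV[R]_d) A : 0 < a ->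
  (lebesgue_outer (fun x => A (a *: x + v)%R) <=
     (a^-1 ^+ d)%:E * lebesgue_outer A)%E.
Proof.
move=> a0; have c0 : 0 < a^-1 ^+ d by rewrite exprn_gt0// invr_gt0.
rewrite -lee_pdivrMl//; apply: le_ereal_inf_tmp => _ [F [mF AF] <-].
rewrite lee_pdivrMl// -nneseriesZl; last by [].
pose w : d.-tuple mR := [tuple v ord0 i | i < d].
apply: ereal_inf_lbound; exists (fun k => tuple_affine a w @^-1` F k).
  split=> [k|t /= At].
    by rewrite -[X in measurable X]setTI; exact: measurable_tuple_affine.
  have [|k _ Fk] := AF (tuple_affine a w t); last by exists k.
  move: At => /=; congr A.
  by apply/rowP => i; rewrite !mxE !tnth_mktuple.
by apply: eq_eseriesr => k _; rewrite lebesgue_tuple_affine.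
Qed.

Lemma lebesgue_outer_affine (a : R) (v : 'rV[R]_d) A : 0 < a ->
  lebesgue_outer (fun x => A (a *: x + v)%R) =
     ((a^-1 ^+ d)%:E * lebesgue_outer A)%E.
Proof.
move=> a0; apply/eqP; rewrite eq_le lebesgue_outer_affine_le//=.
have c0 : 0 < a^-1 ^+ d by rewrite exprn_gt0// invr_gt0.
rewrite -lee_pdivlMl//.
have ai0 : 0 < a^-1 by rewrite invr_gt0.
have := lebesgue_outer_affine_le (- (a^-1 *: v))
  (fun x => A (a *: x + v)) ai0.
rewrite invrK exprVn invrK; congr (lebesgue_outer _ <= _)%E.
apply/funext => x; congr A.
by rewrite scalerDr scalerN !scalerA divff ?gt_eqF// !scale1r subrK.
Qed.

Lemma lebesgue_rV_affine (a : R) (v : 'rV[R]_d) A : 0 < a ->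
  mu (fun x => A (a *: x + v)) = ((a^-1 ^+ d)%:E * mu A)%E.
Proof. exact: lebesgue_outer_affine. Qed.

Lemma lebesgue_rV_shift (v : 'rV[R]_d) A : mu (fun x => A (x + v)) = mu A.
Proof.
rewrite -[RHS]mul1e -[X in (X%:E * _)%E](expr1n R d) -[X in (X ^+ _)%R]invr1.
by rewrite -(lebesgue_rV_affine v A ltr01); congr (mu _); apply/funext => x;
  rewrite scale1r.
Qed.

Lemma le_lebesgue_rV (A B : set 'rV[R]_d) : A `<=` B -> (mu A <= mu B)%E.
Proof. exact: (le_outer_measure (@lebesgue_outer R d)). Qed.

Lemma lebesgue_rV_subadditive (A : (set 'rV[R]_d)^nat) n :
  (mu (\big[setU/set0]_(i < n) A i) <= \sum_(i < n) mu (A i))%E.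
Proof. exact: (outer_measure_subadditive (@lebesgue_outer R d)). Qed.

Lemma lebesgue_rVU2 (A B : set 'rV[R]_d) : (mu (A `|` B) <= mu A + mu B)%E.
Proof. exact: (outer_measureU2 (@lebesgue_outer R d)). Qed.

Lemma lebesgue_rV_cube z r : 0 < r -> mu (cube z r) = ((2 * r) ^+ d)%:E.
Proof.
move=> r0; rewrite -(lebesgue_rV_shift z).
rewrite (_ : (fun x => _) = cube 0 r); last first.
  apply/seteqP; split => x /= H i; have := H i; rewrite !mxE ?subr0 ?addrK//.
rewrite borel_outer; last exact: borel_cube.
have H := @lebesgue_tuple_cube R d `]- r, r[%classic (measurable_itv _).
transitivity (lebesgue_tuple R d [set t | forall i, `]- r, r[%classic (tnth t i)]).
  congr (lebesgue_tuple R d _); apply/seteqP; split => t /= h i;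
  have := h i; by rewrite !mxE subr0 in_itv/= ltr_norml.
rewrite H lebesgue_measure_itv/= lte_fin ifT ?gtrN//.
by rewrite -EFinD opprK -EFin_expe; congr (_ ^+ _)%:E; ring.
Qed.

Lemma lebesgue_rV_sigma_finite : sigma_finite setT mu.
Proof.
exists (fun k => cube 0 (k.+1%:R : R)); last first.
  move=> k; split; first by apply: borel_measurable; exact: borel_cube.
  by rewrite lebesgue_rV_cube// ltry.
apply/esym; rewrite -subTset => x _.
exists (Num.truncn (\sum_i `|x ord0 i|)) => // i.
rewrite mxE subr0; apply: le_lt_trans (truncnS_gt _).
by rewrite (bigD1 i)//= lerDl sumr_ge0.
Qed.

(** The hull is the intersection over n of covers of [A] whose total measure exceeds that of [A] by
    at most 1 / (n + 1). Finiteness turns equality of the measures into nullity of the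
    difference. *)
Lemma borel_hull A : measurable (A : set T) -> (mu A < +oo)%E ->
  exists B, [/\ borel_rV B, A `<=` B & mu (B `\` A) = 0%E].
Proof.
move=> mA Aoo.
have Af : mu A \is a fin_num by rewrite ge0_fin_numE.
have /choice[F HF] n : exists F : (set (d.-tuple mR))^nat,
    measurable_cover (row_of @^-1` A) F /\
    (\sum_(k <oo) lebesgue_tuple R d (F k) <= mu A + (n.+1%:R^-1)%:E)%E.
  have n0 : (0 : R) < n.+1%:R^-1 by [].
  have [_ [F cF <-] h] := lb_ereal_inf_adherent n0 Af.
  by exists F; split => //; exact: ltW.
pose G := \bigcap_n \bigcup_k F n k.
have mG : measurable G.
  by apply: bigcapT_measurable => n; apply: bigcupT_measurable => k;
    have [[]] := HF n.
pose B : set 'rV[R]_d := [set x | G [tuple (x ord0 i : mR) | i < d]].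
have rB : row_of @^-1` B = G.
  apply/seteqP; split => t /=; congr G; apply: eq_from_tnth => i;
  by rewrite tnth_mktuple mxE.
have bB : borel_rV B by rewrite /borel_rV rB.
have mB := borel_measurable bB.
have AB : A `<=` B.
  move=> x Ax n _; have [[_ h] _] := HF n; apply: h => /=.
  by rewrite row_ofK.
have BA : (mu B <= mu A)%E.
  apply/lee_addgt0Pr => e e0.
  have [n _ /(_ n (leqnn _)) /= Hn] := near_infty_natSinv_lt (PosNum e0).
  apply: (@le_trans _ _ (mu A + (n.+1%:R^-1)%:E)%E); last first.
    by rewrite leeD2l// lee_fin ltW.
  have [[mF _] hF] := HF n; apply: le_trans hF.
  rewrite borel_outer// rB.
  apply: (@le_trans _ _ (lebesgue_tuple R d (\bigcup_k F n k))).
    apply: le_measure; rewrite ?inE//; first exact: bigcupT_measurable.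
    by move=> t; exact.
  by apply: measure_sigma_subadditive => //; exact: bigcupT_measurable.
exists B; split => //.
have BE : mu B = mu A.
  by apply/eqP; rewrite eq_le BA/= le_measure ?inE.
transitivity (mu B - mu A)%E; last by rewrite BE subee.
have Boo : (mu B < +oo)%E by rewrite BE.
have BAE : B `&` A = A by rewrite setIidr.
by rewrite -[in RHS]BAE; exact: measureD.
Qed.

End outer_affine.

HB.instance Definition _ (R : realType) (d : nat) :=
  @Measure_isSigmaFinite.Build _ _ _ (@lebesgue_rV R d)
    (@lebesgue_rV_sigma_finite R d).


(** * Lipschitz domains *)

Section norms.
Context {R : realType} {d : nat}.
Implicit Types (x y z w : 'rV[R]_d) (r s : R).

Lemma ler_coord_norm x (i : 'I_d) : `|x ord0 i| <= `|x|.
Proof.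
rewrite {2}/Num.norm /= mx_normrE; apply/bigmax_geP; right.
by exists (ord0, i).
Qed.

Lemma ler_norm_coord x r : 0 <= r -> (forall i, `|x ord0 i| <= r) -> `|x| <= r.
Proof.
move=> r0 H; rewrite /Num.norm /= mx_normrE; apply/bigmax_leP; split => //.
by move=> [i j] _ /=; rewrite ord1.
Qed.

Lemma enorm_le_coord x r : 0 <= r -> (forall i, `|x ord0 i| <= r) ->
  enorm x <= d%:R * r.
Proof.
move=> r0 H; rewrite /enorm -[leRHS]ger0_norm ?mulr_ge0// -sqrtr_sqr.
apply: ler_wsqrtr; apply: (@le_trans _ _ (\sum_(i < d) r ^+ 2)).
  by apply: ler_sum => i _; rewrite -real_normK ?num_real// lerXn2r ?nnegrE.
rewrite sumr_const card_ord exprMn -[leLHS]mulr_natl ler_wpM2r ?sqr_ge0//.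
by rewrite -natrX ler_nat; case: (d) => // n; rewrite -[leqLHS]expn1 leq_pexp2l.
Qed.

Lemma is_norm_le_coord (N : 'rV[R]_d -> R) x r : is_norm N -> 0 <= r ->
  (forall i, `|x ord0 i| <= r) ->
  N x <= r * \sum_(i < d) N (delta_mx ord0 i).
Proof.
move=> [N0 _ NZ ND] r0 H.
have ND' (J : seq 'I_d) (f : 'I_d -> 'rV[R]_d) :
    N (\sum_(i <- J) f i) <= \sum_(i <- J) N (f i).
  elim: J => [|i J IH]; first by rewrite !big_nil -(scale0r 0) NZ normr0 mul0r.
  by rewrite !big_cons (le_trans (ND _ _))// lerD2l.
rewrite [in leLHS](row_sum_delta x) (le_trans (ND' _ _))// mulr_sumr.
by apply: ler_sum => i _; rewrite NZ ler_wpM2r.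
Qed.

End norms.

Section interior_cubes.
Context {R : realType} {d : nat}.
Implicit Types (x y z w : 'rV[R]_d) (Omega : set 'rV[R]_d).

(** A uniform interior cone condition near [x], the directions filling a cube about [z] and the
    times going up to [sigma]. Cubes are used because they are Borel sets of explicit measure. *)
Definition inner_cube Omega x (p : R * 'rV[R]_d * R * R) :=
  let: (r, z, eta, sigma) := p in
  [/\ 0 < r, 0 < eta, 0 < sigma & forall y w s, cube x r y -> Omega y ->
     cube z eta w -> 0 < s <= sigma -> Omega (y + s *: w)].

Lemma inner_cube_interior Omega x : open Omega -> Omega x ->
  exists p, inner_cube Omega x p.
Proof.
move=> oO Ox.
have /nbhs_ballP[e /= e0 He] : nbhs x Omega by exact: open_nbhs_nbhs.
have e2 : 0 < e / 2 by rewrite divr_gt0.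
exists (e / 2, 0, e / 2, 1); split => // y w s yx _ w0 /andP[s0 s1].
apply: He; rewrite ball_cube// => i; rewrite !mxE addrAC (splitr e).
rewrite (le_lt_trans (ler_normD _ _))// ltrD ?yx//.
rewrite normrM (gtr0_norm s0) (le_lt_trans _ (w0 i))// mxE subr0.
by rewrite ler_piMl.
Qed.

(** In the coordinates given by [Q], [z] is the vertical direction. A direction in the cube rises at
    rate at least 1 - eta B and moves sideways at rate at most eta B, so the graph below it rises at
    rate at most L eta B. The choice (L + 1) eta B = 1 balances the two. *)
Lemma inner_cube_epigraph Omega x (Q : 'M[R]_d) (j : 'I_d)
    (g : 'rV[R]_(d.-1) -> R) (r : R) :
  Q *m Q^T = 1%:M -> lipschitz g -> 0 < r ->
  (forall y, enorm (y - x) < r ->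
    Omega y <-> g (col' j (y *m Q)) < (y *m Q) ord0 j) ->
  exists p, inner_cube Omega x p.
Proof.
move=> QQ [M [_ Mlip]] r0 HO.
(* [lipschitz] gives the estimate for every constant above some [M]; this one is also positive. *)
pose L := `|M| + 1.
have L0 : 0 < L by rewrite ltr_pwDr.
have gL u v : `|g u - g v| <= L * `|u - v|.
  by apply: (Mlip L _ (u, v)) => //; rewrite ltr_pwDr ?ler_norm.
pose z := delta_mx ord0 j *m Q^T : 'rV[R]_d.
have zQ : z *m Q = delta_mx ord0 j.
  by rewrite -mulmxA (mulmx1C QQ) mulmx1.
pose B := 1 + \sum_k \sum_i `|Q k i|.
have B0 : 0 < B.
  by rewrite ltr_pwDl// sumr_ge0// => k _; rewrite sumr_ge0.
pose eta := (B * (L + 1))^-1.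
have eta0 : 0 < eta by rewrite invr_gt0 mulr_gt0// addr_gt0.
have wQ w : cube z eta w -> forall i,
    `|(w *m Q) ord0 i - (delta_mx ord0 j : 'rV[R]_d) ord0 i| <= eta * B.
  move=> wz i; rewrite -zQ.
  have -> : (w *m Q) ord0 i - (z *m Q) ord0 i = ((w - z) *m Q) ord0 i.
    by rewrite mulmxBl !mxE.
  rewrite mxE (le_trans (ler_norm_sum _ _ _))//.
  apply: (@le_trans _ _ (\sum_k eta * `|Q k i|)).
    apply: ler_sum => k _; rewrite normrM ler_wpM2r//.
    by have := wz k; rewrite !mxE => /ltW.
  rewrite -mulr_sumr ler_pM2l// /B ler_wpDl// ler_sum// => k _.
  by rewrite (bigD1 i)//= lerDl sumr_ge0.
(* The Euclidean norm is at most d times the sup norm, and d + 1 makes the estimate strict. Half of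
   the radius r / D is kept for y - x and half for s w. *)
pose D := d%:R + 1 : R.
have D0 : 0 < D by rewrite ltr_pwDr.
pose W := eta + `|z|.
have W0 : 0 < W by rewrite ltr_pwDl.
pose r1 := r / (2 * D).
have r10 : 0 < r1 by rewrite divr_gt0// mulr_gt0.
exists (r1, z, eta, r1 / W); split => //; first by rewrite divr_gt0.
move=> y w s yx Oy wz /andP[s0 s1].
have wW i : `|w ord0 i| <= W.
  rewrite -(subrK (z ord0 i) (w ord0 i)) (le_trans (ler_normD _ _))//.
  by rewrite lerD ?ler_coord_norm// ltW.
have small (v : 'rV[R]_d) : (forall i, `|v ord0 i| <= 2 * r1) -> enorm v < r.
  have r12 : 0 <= 2 * r1 by rewrite mulr_ge0// ltW.
  move=> h; rewrite (le_lt_trans (enorm_le_coord r12 h))//.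
  have -> : 2 * r1 = r / D by rewrite /r1; field; rewrite gt_eqF.
  by rewrite mulrA ltr_pdivrMr// mulrC ltr_pM2l// ltrDl.
have ysw i : `|(y + s *: w - x) ord0 i| <= 2 * r1.
  rewrite !mxE addrAC (le_trans (ler_normD _ _))// mulr_natl mulr2n.
  rewrite lerD//; first exact/ltW/yx.
  rewrite normrM (gtr0_norm s0) (le_trans (ler_pM _ _ s1 (wW i)))//; first exact: ltW.
  by rewrite divfK ?gt_eqF.
have yx2 i : `|(y - x) ord0 i| <= 2 * r1.
  rewrite !mxE (le_trans (ltW (yx i)))// ler_peMl ?(ltW r10)//.
  by rewrite ler1n.
apply/HO; first exact: small.
have /HO := Oy; move=> /(_ (small _ yx2)) gy.
set u := y *m Q in gy *.
have -> : (y + s *: w) *m Q = u + s *: (w *m Q).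
  by rewrite mulmxDl scalemxAl.
set v := w *m Q.
have vj : 1 - eta * B <= v ord0 j.
  have := wQ _ wz j; rewrite [(delta_mx _ _) _ _]mxE !eqxx ler_distl => /andP[h _]; exact: h.
have v' : `|col' j v| <= eta * B.
  apply: ler_norm_coord => [|i]; first by rewrite mulr_ge0 ?ltW.
  have := wQ _ wz (lift j i); rewrite !mxE eqxx /= eq_sym (negbTE (neq_lift _ _)).
  by rewrite subr0.
have etaB : (L + 1) * (eta * B) = 1.
  rewrite /eta; field; rewrite !gt_eqF// addr_gt0//.
have -> : col' j (u + s *: v) = col' j u + s *: col' j v.
  by apply/rowP => i; rewrite !mxE.
have := gL (col' j u + s *: col' j v) (col' j u).
rewrite addrAC subrr add0r normrZ (gtr0_norm s0) ler_distl => /andP[_ h].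
rewrite (le_lt_trans h)// [X in _ < X]mxE [X in _ < _ + X]mxE.
rewrite ltr_leD// mulrCA ler_pM2l//.
apply: le_trans vj; rewrite (le_trans (ler_wpM2l (ltW L0) v'))//.
by rewrite lerBrDr -[X in _ + X]mul1r -mulrDl etaB.
Qed.

Lemma norm_le_coord_bounded x r : `|x| <= r -> forall i, `|x ord0 i| <= r.
Proof. by move=> h i; rewrite (le_trans (ler_coord_norm _ _)). Qed.

Lemma bounded_setP Omega : bounded_set Omega ->
  exists2 M : R, 0 < M & forall x, Omega x -> forall i, `|x ord0 i| <= M.
Proof.
move=> [M [_ HM]]; exists (`|M| + 1); first by rewrite ltr_pwDr.
move=> x Ox; apply: norm_le_coord_bounded; apply: HM => //.
by rewrite ltr_pwDr ?ler_norm.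
Qed.

Lemma compact_closure_bounded Omega : bounded_set Omega -> compact (closure Omega).
Proof.
move=> [M [Mr HM]]; apply: bounded_closed_compact; last exact: closed_closure.
exists M; split => // k /HM kM x; rewrite /closure => Ox /=.
apply: contrapT => /negP; rewrite -ltNge => kx.
have e0 : 0 < `|x| - k by rewrite subr_gt0.
have [y [Oy]] := Ox _ (nbhsx_ballx x _ e0).
rewrite -ball_normE /= => xy.
have := kM _ Oy; apply/negP; rewrite -ltNge.
rewrite -(ltrD2l `|x - y|); apply: (@lt_le_trans _ _ `|x|).
  by rewrite -ltrBrDr.
by rewrite -{1}(subrK y x) ler_normD.
Qed.

(** Compactness of the closure leaves finitely many cubes. Shrinking the directions at x by [tau0 x]
    normalises the times to s <= 1 and the lengths to N w < 1; [e0] is a size common to all the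
    rescaled cubes. *)
Lemma lipschitz_inner_cubes Omega (N : 'rV[R]_d -> R) :
  open Omega -> bounded_set Omega -> lipschitz_boundary Omega -> is_norm N ->
  exists (J : seq 'rV[R]_d) (U : 'rV[R]_d -> set 'rV[R]_d)
    (z : 'rV[R]_d -> 'rV[R]_d) (eta : R),
  [/\ 0 < eta, forall i, open (U i),
      forall y, Omega y -> exists2 i, i \in J & U i y &
      forall i y w s, i \in J -> U i y -> Omega y -> cube (z i) eta w ->
        0 < s <= 1 -> Omega (y + s *: w) /\ N w < 1].
Proof.
move=> oO bO lO NN.
have /choice[p Hp] : forall x, exists p, closure Omega x -> inner_cube Omega x p.
  move=> x; have [cx|] := pselect (closure Omega x); last by exists (0, 0, 0, 0).
  have [Ox|nOx] := pselect (Omega x).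
    by have [p] := inner_cube_interior oO Ox; exists p.
  have [|Q [j [g [r [QQ lg r0 H]]]]] := lO x.
    by split => // /interior_subset.
  by have [p] := inner_cube_epigraph QQ lg r0 H; exists p.
have : compact (closure Omega) := compact_closure_bounded bO.
rewrite compact_cover => /(_ _ (closure Omega) (fun x => (ball x (p x).1.1.1)^°)).
case.
- by move=> i _; exact: open_interior.
- move=> x cx; exists x => //; rewrite /= /interior.
  have := Hp _ cx; case: (p x) => -[[r z] eta] sigma [r0 _ _ _] /=.
  exact: nbhsx_ballx.
move=> J0 JD0 Jcov0.
pose J : seq 'rV[R]_d := finmap.enum_fset J0.
have JD x : x \in J -> closure Omega x.
  by move=> xJ; have := JD0 x xJ; rewrite inE.
have Jcov y : Omega y -> exists2 x, x \in J & (ball x (p x).1.1.1)^° y.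
  by move=> Oy; have [x xJ xy] := Jcov0 _ (subset_closure Oy); exists x.
move: J JD Jcov => J JD Jcov {J0 JD0 Jcov0}.
pose S := \sum_(i < d) N (delta_mx ord0 i).
have S0 : 0 <= S by rewrite sumr_ge0//; case: NN.
(* The first argument of the minimum gives s * tau <= sigma, the second N w < 1, because N is at
   most [S] times the sup norm. *)
pose tau0 x := Num.min (p x).2 (1 + ((p x).1.2 + `|(p x).1.1.2|) * S)^-1.
have tau00 x : x \in J -> 0 < tau0 x.
  move=> /JD cx; have := Hp _ cx; rewrite /tau0.
  case: (p x) => -[[r z] eta] sigma [_ eta0 sigma0 _] /=.
  by rewrite lt_min sigma0 invr_gt0 ltr_pwDl// mulr_ge0// addr_ge0// ltW.
pose e0 := \big[Num.min/1]_(x <- J) (tau0 x * (p x).1.2).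
have e00 : 0 < e0.
  rewrite /e0 big_seq; elim/big_ind : _ => //; first by move=> u v; rewrite lt_min => -> ->.
  move=> x xJ; rewrite mulr_gt0// ?tau00//; have cx := JD _ xJ.
  by have := Hp _ cx; case: (p x) => -[[r z] eta] sigma [_ ? _ _].
have e0le x : x \in J -> e0 <= tau0 x * (p x).1.2.
  rewrite /e0; elim: (J) => // a J' IH; rewrite inE big_cons ge_min.
  by case/predU1P => [->|/IH ->]; rewrite ?lexx ?orbT.
exists J, (fun x => (ball x (p x).1.1.1)^°),
  (fun x => tau0 x *: (p x).1.1.2), e0; split => //.
- by move=> x; exact: open_interior.
move=> x y w s xJ Uy Oy wz /andP[s0 s1].
have := tau00 _ xJ; have := e0le _ xJ.
have cx := JD _ xJ.
have := Hp _ cx; move: wz Uy; rewrite /tau0; case: (p x) => -[[r z] eta] sigma /=.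
set tau := Num.min _ _ => wz /interior_subset Uy [r0 eta0 sigma0 H] le_e0 tau_gt0.
have wE : w = tau *: (tau^-1 *: w) by rewrite scalerA divff ?gt_eqF// scale1r.
have w'z : cube z eta (tau^-1 *: w).
  move=> i; rewrite mxE -(@ltr_pM2l _ tau)// -{1}(gtr0_norm tau_gt0) -normrM mulrBr.
  rewrite mulrA divff ?gt_eqF// mul1r (lt_le_trans _ le_e0)//.
  by have := wz i; rewrite mxE.
split.
  rewrite wE scalerA; apply: H => //; first by rewrite -ball_cube.
  rewrite mulr_gt0//= (@le_trans _ _ tau)//; first by rewrite ler_piMl// ltW.
  by rewrite /tau ge_min lexx.
rewrite wE; have [_ _ -> _] := NN; rewrite (gtr0_norm tau_gt0).
have /(is_norm_le_coord NN) : 0 <= eta + `|z| by rewrite addr_ge0// ltW.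
move=> /(_ (tau^-1 *: w)) h.
have {}h : N (tau^-1 *: w) <= (eta + `|z|) * S.
  apply: h => i; rewrite -(subrK (z ord0 i) ((tau^-1 *: w) ord0 i)).
  rewrite (le_trans (ler_normD _ _))// lerD ?ler_coord_norm//.
  exact/ltW/w'z.
apply: (@le_lt_trans _ _ (tau * ((eta + `|z|) * S))).
  by rewrite ler_pM2l.
have X0 : 0 <= (eta + `|z|) * S by rewrite mulr_ge0// addr_ge0// ltW.
apply: (@le_lt_trans _ _ ((1 + (eta + `|z|) * S)^-1 * ((eta + `|z|) * S))).
  by rewrite ler_wpM2r// /tau ge_min lexx orbT.
by rewrite mulrC ltr_pdivrMr ?ltr_pwDl// mul1r ltrDr.
Qed.

End interior_cubes.


(** * The translation argument *)

Section integral_monotone.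
Local Open Scope ereal_scope.
Context d (T : measurableType d) (R : realType).
Variable mu : {measure set T -> \bar R}.

(* Unlike [ge0_le_integral], no measurability is assumed. *)
Lemma le_integral_nonneg (D : set T) (f1 f2 : T -> \bar R) :
  (forall x, D x -> 0 <= f1 x) -> (forall x, D x -> f1 x <= f2 x) ->
  \int[mu]_(x in D) f1 x <= \int[mu]_(x in D) f2 x.
Proof.
move=> f10 f12; rewrite (integral_mkcond D f1) (integral_mkcond D f2).
have g10 x : 0 <= (f1 \_ D) x by apply: erestrict_ge0.
have g12 x : (f1 \_ D) x <= (f2 \_ D) x by apply: lee_restrict.
have g20 x : 0 <= (f2 \_ D) x by apply: le_trans (g12 x).
rewrite !ge0_integralTE//; apply: le_ereal_sup => _ [h hf <-].
by exists h => // x; rewrite (le_trans (hf x)).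
Qed.

Lemma subset_integral_nonneg (A B : set T) (f : T -> \bar R) : A `<=` B ->
  (forall x, B x -> 0 <= f x) ->
  \int[mu]_(x in A) f x <= \int[mu]_(x in B) f x.
Proof.
move=> AB f0; rewrite (integral_mkcond A) (integral_mkcond B).
apply: le_integral_nonneg => x _; first by apply: erestrict_ge0 => y /AB /f0.
rewrite !patchE; case: ifPn => [|_]; first by rewrite inE => /AB/mem_set ->.
by case: ifPn => //; rewrite inE => /f0.
Qed.

End integral_monotone.

Section product_lebesgue.
Context {R : realType} {d : nat}.
Local Notation mR := (measurableTypeR R).
Local Notation T := (lebesgue_type R d).
Local Notation mu := (@lebesgue_rV R d).
Implicit Types (A : set 'rV[R]_d) (N : 'rV[R]_d -> R).

Lemma measurable_affine_prod (a b : R) A : borel_rV A ->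
  measurable [set p : T * T | A (a *: (p.1 : 'rV[R]_d) + b *: (p.2 : 'rV[R]_d))].
Proof.
move=> bA.
apply: (@measurable_preimage_borel R d _ (T * T)%type
  (fun p => a *: (p.1 : 'rV[R]_d) + b *: (p.2 : 'rV[R]_d))) => // i.
rewrite (_ : (fun _ => _) = fun p : T * T =>
   a * (p.1 : 'rV[R]_d) ord0 i + b * (p.2 : 'rV[R]_d) ord0 i); last first.
  by apply/funext => p; rewrite !mxE.
apply: measurable_funD; apply: measurable_funM => //.
  by apply: (measurableT_comp (measurable_coord i)).
by apply: (measurableT_comp (measurable_coord i)).
Qed.

Lemma measurable_fst_borel A : borel_rV A -> measurable [set p : T * T | A p.1].
Proof.
move=> /(measurable_affine_prod 1 0); congr measurable.
by apply/funext => p /=; rewrite scale1r scale0r addr0.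
Qed.

Lemma measurable_snd_borel A : borel_rV A -> measurable [set p : T * T | A p.2].
Proof.
move=> /(measurable_affine_prod 0 1); congr measurable.
by apply/funext => p /=; rewrite scale1r scale0r add0r.
Qed.

Lemma product_measure12 (A : set (T * T)) : measurable A ->
  (\int[mu]_x mu (xsection A x) = \int[mu]_y mu (ysection A y))%E.
Proof.
move=> mA.
have := @indic_fubini_tonelli _ _ T T R mu mu A mA.
rewrite indic_fubini_tonelli_FE// indic_fubini_tonelli_GE//.
Qed.

Lemma integralZl_xsection (A : set (T * T)) (k : R) : measurable A -> 0 <= k ->
  (\int[mu]_x (k%:E * mu (xsection A x)) = k%:E * \int[mu]_x mu (xsection A x))%E.
Proof.
move=> mA k0.
apply: (@ge0_integralZl_EFin _ T R mu setT measurableT (fun x => mu (xsection A x))).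
- by [].
- exact: (measurable_fun_xsection mu mA).
- exact: k0.
Qed.

Lemma integralZl_ysection (A : set (T * T)) (k : R) : measurable A -> 0 <= k ->
  (\int[mu]_x (k%:E * mu (ysection A x)) = k%:E * \int[mu]_x mu (ysection A x))%E.
Proof.
move=> mA k0.
apply: (@ge0_integralZl_EFin _ T R mu setT measurableT (fun x => mu (ysection A x))).
- by [].
- exact: (measurable_fun_ysection mu mA).
- exact: k0.
Qed.

Lemma is_norm_open N (r : R) : is_norm N -> open [set x | N x < r].
Proof.
move=> NN; rewrite openE => x /= Nx.
pose S := \sum_(i < d) N (delta_mx ord0 i).
have S0 : 0 <= S by rewrite sumr_ge0//; case: NN.
pose e := (r - N x) / (S + 1).
have e0 : 0 < e by rewrite divr_gt0 ?subr_gt0// ltr_pwDr.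
apply/nbhs_ballP; exists e => //= y; rewrite ball_cube// => yx /=.
have := is_norm_le_coord NN (ltW e0) (x := y - x).
have h i : `|(y - x) ord0 i| <= e by rewrite !mxE; exact/ltW/yx.
move=> /(_ h); rewrite -/S => {}h.
have [_ _ _ ND] := NN.
rewrite -(subrK x y) (le_lt_trans (ND _ _))// -ltrBrDr (le_lt_trans h)//.
by rewrite /e mulrAC ltr_pdivrMr ?ltr_pwDr// ltr_pM2l ?subr_gt0// ltrDl.
Qed.

Lemma is_normN N x : is_norm N -> N (- x) = N x.
Proof. by move=> [_ _ NZ _]; rewrite -scaleN1r NZ normrN1 mul1r. Qed.

Lemma is_norm0 N : is_norm N -> N 0 = 0.
Proof. by move=> [_ _ NZ _]; rewrite -(scale0r 0) NZ normr0 mul0r. Qed.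

End product_lebesgue.

Section relative_isoperimetry.
Context {R : realType} {d : nat}.
Local Notation mR := (measurableTypeR R).
Local Notation T := (lebesgue_type R d).
Local Notation mu := (@lebesgue_rV R d).
Implicit Types (Omega F U : set 'rV[R]_d) (N : 'rV[R]_d -> R).

Definition separated Omega N F (s : R) : set (T * T) :=
  [set p | [/\ Omega p.1, Omega p.2, N (p.1 - p.2) < s &
               ((p.1 : 'rV[R]_d) \in F) != ((p.2 : 'rV[R]_d) \in F)]].

(** The second coordinate is a direction, not an end point: [C] does not depend on [s], so a long
    displacement can be cut into short ones in the same direction. *)
Definition displaced Omega F (C : set 'rV[R]_d) (s : R) : set (T * T) :=
  [set p | [/\ Omega p.1, Omega (p.1 + s *: p.2)%R, C p.2 &
     ((p.1 : 'rV[R]_d) \in F) != ((p.1 + s *: p.2)%R \in F)]].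

Lemma telescope_neq (b : nat -> bool) n : b 0%N != b n ->
  exists2 j, (j < n)%N & b j != b j.+1.
Proof.
elim: n => [|n IH]; first by rewrite eqxx.
have [e|/IH[j jn h] _] := eqVneq (b 0%N) (b n).
  by rewrite e => h; exists n.
by exists j => //; rewrite ltnS ltnW.
Qed.

Lemma neq_setE (A B : set (T * T)) :
  [set p | (p \in A) != (p \in B)] = (A `\` B) `|` (B `\` A).
Proof.
apply/seteqP; split => p /=.
  case: (boolP (p \in A)); case: (boolP (p \in B)) => //; rewrite ?inE ?notin_setE.
    by move=> ? ? _; left.
  by move=> ? ? _; right.
move=> [[pA pB]|[pB pA]].
  by rewrite (mem_set pA) (memNset pB).
by rewrite (mem_set pB) (memNset pA).
Qed.

Lemma measurable_neq (A B : set (T * T)) : measurable A -> measurable B ->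
  measurable [set p | (p \in A) != (p \in B)].
Proof.
by move=> mA mB; rewrite neq_setE; apply: measurableU; apply: measurableD.
Qed.

Lemma measurable_separated Omega N F s : borel_rV Omega -> is_norm N ->
  borel_rV F -> measurable (separated Omega N F s).
Proof.
move=> bO NN bF.
have -> : separated Omega N F s = [set p : T * T | Omega p.1] `&`
  [set p : T * T | Omega p.2] `&` [set p : T * T | [set x | N x < s]
     (1 *: (p.1 : 'rV[R]_d) + (-1) *: (p.2 : 'rV[R]_d))] `&`
  [set p | (p \in [set p : T * T | F p.1]) != (p \in [set p : T * T | F p.2])].
  apply/seteqP; split => p /=; rewrite scale1r scaleN1r.
    by move=> [? ? ? h]; split=> //; move: h; rewrite /in_mem /= /in_set.
  by move=> [[[? ?] ?] h]; split=> //; move: h; rewrite /in_mem /= /in_set.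
apply: measurableI; last first.
  apply: measurable_neq; [exact: measurable_fst_borel|exact: measurable_snd_borel].
apply: measurableI.
  by apply: measurableI; [exact: measurable_fst_borel|exact: measurable_snd_borel].
by apply: measurable_affine_prod; apply: borel_open; exact: is_norm_open.
Qed.

Lemma measurable_displaced Omega F C s : borel_rV Omega -> borel_rV C ->
  borel_rV F -> measurable (displaced Omega F C s).
Proof.
move=> bO bC bF.
have -> : displaced Omega F C s = [set p : T * T | Omega p.1] `&`
  [set p : T * T | C p.2] `&` [set p : T * T | Omega
     (1 *: (p.1 : 'rV[R]_d) + s *: (p.2 : 'rV[R]_d))] `&`
  [set p | (p \in [set p : T * T | F p.1]) != (p \in [set p : T * T | F
     (1 *: (p.1 : 'rV[R]_d) + s *: (p.2 : 'rV[R]_d))])].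
  apply/seteqP; split => p /=; rewrite scale1r.
    by move=> [? ? ? h]; split=> //; move: h; rewrite /in_mem /= /in_set /= scale1r.
  by move=> [[[? ?] ?] h]; split=> //; move: h; rewrite /in_mem /= /in_set /= scale1r.
apply: measurableI; last first.
  apply: measurable_neq; [exact: measurable_fst_borel|exact: measurable_affine_prod].
apply: measurableI; last exact: measurable_affine_prod.
by apply: measurableI; [exact: measurable_fst_borel|exact: measurable_snd_borel].
Qed.


Variables (Omega U C : set 'rV[R]_d) (N : 'rV[R]_d -> R) (F : set 'rV[R]_d).
Hypotheses (bO : borel_rV Omega) (bU : borel_rV U) (bC : borel_rV C).
Hypotheses (NN : is_norm N) (bF : borel_rV F).
Hypothesis inner : forall y w s, U y -> Omega y -> C w -> 0 < s <= 1 ->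
  Omega (y + s *: w) /\ N w < 1.

(** Only displacements that start in [U] are known to stay in [Omega]. Later points of a chain may
    leave [U], so the telescoped bound is by [displaced] without this restriction. *)
Let from (s : R) : set (T * T) :=
  [set p : T * T | U p.1] `&` displaced Omega F C s.

Let measurable_from s : measurable (from s).
Proof.
apply: measurableI; first exact: measurable_fst_borel.
exact: measurable_displaced.
Qed.

(** Tonelli puts the direction w outside. For fixed w, if [F] separates x from x + n s w, it
    separates two consecutive points x + j s w. The set of x belonging to one j is a translate of a
    fixed set, so every j costs the same measure. *)
Lemma displaced_telescope (s : R) n : 0 < s -> n%:R * s <= 1 ->
  (\int[mu]_x mu (xsection (from (n%:R * s)) x) <=
   n%:R%:E * \int[mu]_x mu (xsection (displaced Omega F C s) x))%E.
Proof.
move=> s0 ns1.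
have mD := measurable_displaced s bO bC bF.
rewrite (product_measure12 (measurable_from _)) (product_measure12 mD).
rewrite -(integralZl_ysection mD (ler0n _ _)).
apply: le_integral_nonneg => // w _.
pose S (j : nat) : set 'rV[R]_d := fun x =>
  ysection (displaced Omega F C s) w (x + (j%:R * s) *: (w : 'rV[R]_d)).
apply: (@le_trans _ _ (\sum_(j < n) mu (S j))%E); last first.
  under eq_bigr do rewrite lebesgue_rV_shift.
  by rewrite sumr_const card_ord /= mule_natl.
apply: (le_trans _ (lebesgue_rV_subadditive S n)); apply: le_lebesgue_rV => x.
move=> Hx; have {Hx}[Ux [Ox Onx Cw]] : from (n%:R * s) (x, w) by exact: set_mem Hx.
have K j : x + (j.+1%:R * s) *: (w : 'rV[R]_d) = x + (j%:R * s) *: w + s *: w.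
  by rewrite -addrA -scalerDl -natr1 mulrDl mul1r.
move=> h; have [|j jn hj] := @telescope_neq
    (fun j => (x + (j%:R * s) *: (w : 'rV[R]_d)) \in F) n.
  by rewrite mul0r scale0r addr0.
(* [inner] is applied at the starting point with time i s <= 1, never at an intermediate point,
   which may lie outside [U]. *)
have Oj i : (i <= n)%N -> Omega (x + (i%:R * s) *: w).
  case: i => [|i] le_in; first by rewrite mul0r scale0r addr0.
  have H01 : 0 < i.+1%:R * s <= 1.
    by rewrite mulr_gt0//= (le_trans _ ns1)// ler_wpM2r ?(ltW s0)// ler_nat.
  by have [] := inner Ux Ox Cw H01.
suff : (\bigcup_(i in `I_n) S i) x by rewrite bigcup_mkord.
exists j => //.
suff : displaced Omega F C s (x + (j%:R * s) *: (w : 'rV[R]_d), w).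
  by move=> H; exact: mem_set.
split => //=; first by apply: Oj; exact: ltnW.
  by rewrite -K; exact: Oj.
by rewrite -K.
Qed.

(** For x in [F] and [U], the w with x + s w in [F] have measure s^-d m. All other w in [C] carry x
    out of [F] but not out of [Omega]. *)
Lemma displaced_lower (s m c : R) : 0 < s -> s <= 1 -> F `<=` Omega ->
  mu F = m%:E -> mu C = c%:E -> s^-1 ^+ d * m <= c ->
  (mu (F `&` U) * (c - s^-1 ^+ d * m)%:E <=
    \int[mu]_x mu (xsection (from s) x))%E.
Proof.
move=> s0 s1 FO mF mC mc.
have bFU : measurable ((F `&` U) : set T).
  by apply: measurableI; exact: borel_measurable.
rewrite muleC -integral_cst//.
apply: (@le_trans _ _ (\int[mu]_(x in F `&` U) mu (xsection (from s) x))%E); last first.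
  exact: subset_integral_nonneg.
apply: le_integral_nonneg => [x _ /=|x [Fx Ux]]; first by rewrite lee_fin subr_ge0.
pose G : set 'rV[R]_d := [set w | F (x + s *: w)].
have mG : mu G = (s^-1 ^+ d * m)%:E.
  rewrite EFinM -mF -(lebesgue_rV_affine x F s0); congr (mu _).
  by apply/funext => w; rewrite /G /= addrC.
apply: (@le_trans _ _ (mu (C `\` G))); last first.
  apply: le_lebesgue_rV => w [Cw Gw]; rewrite /xsection /= inE /=; split => //.
  split => //=; first exact: FO.
    have H01 : 0 < s <= 1 by rewrite s0.
    by have [] := inner Ux (FO _ Fx) Cw H01.
  rewrite [X in X != _](mem_set Fx).
  by rewrite [X in _ != X](_ : _ = false)//; exact: memNset.
rewrite EFinB -mG leeBlDr ?mG//.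
rewrite -mC -[X in (_ <= _ + X)%E]mG.
apply: (@le_trans _ _ (mu ((C `\` G) `|` G))).
  by apply: le_lebesgue_rV => w Cw; have [Gw|Gw] := pselect (G w); [right|left].
exact: lebesgue_rVU2.
Qed.

(** For fixed x, the substitution y = x + s w, of Jacobian s^d, sends the directions to points
    separated from x. *)
Lemma displaced_separated (s : R) : 0 < s ->
  (forall w, C w -> N w < 1) ->
  ((s ^+ d)%:E * \int[mu]_x mu (xsection (displaced Omega F C s) x) <=
   \int[mu]_x mu (xsection (separated Omega N F s) x))%E.
Proof.
move=> s0 CN.
have mD := measurable_displaced s bO bC bF.
rewrite -(integralZl_xsection mD (exprn_ge0 d (ltW s0))).
apply: le_integral_nonneg => x _.
  by rewrite mule_ge0// lee_fin exprn_ge0// ltW.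
have sd : 0 < s ^+ d by rewrite exprn_gt0.
rewrite -lee_pdivlMl// -exprVn -(lebesgue_rV_affine x _ s0).
apply: le_lebesgue_rV => w; rewrite /xsection /= !inE /= => -[Ox Osw Cw h].
rewrite addrC; split => //=.
rewrite opprD addrA subrr add0r (is_normN _ NN).
have [_ _ -> _] := NN.
by rewrite (gtr0_norm s0) -[ltRHS]mulr1 ltr_pM2l// CN.
Qed.

End relative_isoperimetry.


(** * Measure of the pairs separated inside a Lipschitz domain *)

Section separated_lower.
Context {R : realType} {d : nat}.
Local Notation T := (lebesgue_type R d).
Local Notation mu := (@lebesgue_rV R d).
Implicit Types (Omega F : set 'rV[R]_d) (N : 'rV[R]_d -> R).

(** n is the integer part of k r / s, plus one. If k r < s then n = 1; otherwise n s <= 2 k r <=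
    1. *)
Lemma ex_dilation (k r s : R) : 1 <= k -> 0 < r -> 2 * k * r <= 1 ->
  0 < s <= 1 -> exists n : nat, [/\ (0 < n)%N, k * r <= n%:R * s, n%:R * s <= 1 &
    n%:R * Num.min 1 (s / r) <= 2 * k].
Proof.
move=> k1 r0 kr /andP[s0 s1].
have k0 : 0 < k by exact: lt_le_trans k1.
have krs : 0 <= k * r / s by rewrite divr_ge0 ?mulr_ge0 ?ltW.
exists (Num.truncn (k * r / s)).+1.
have ngt : k * r <= (Num.truncn (k * r / s)).+1%:R * s.
  by rewrite -ler_pdivrMr// ltW// truncnS_gt.
have [krs1|skr] := ltP (k * r) s.
  have -> : Num.truncn (k * r / s) = 0%N.
    by apply/truncn0Pn; rewrite -ltNge ltr_pdivrMr// mul1r.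
  rewrite !mul1r; split => //; first exact: ltW.
  by rewrite ge_min (@le_trans _ _ k)// ler_peMl ?(ltW k0)// ler1n.
have nle : (Num.truncn (k * r / s)).+1%:R * s <= 2 * k * r.
  rewrite -natr1 mulrDl mul1r -[leRHS]mulrA [leRHS]mulr_natl mulr2n lerD//.
  by rewrite -ler_pdivlMr// truncn_le.
split => //; first exact: le_trans kr.
apply: (@le_trans _ _ ((Num.truncn (k * r / s)).+1%:R * (s / r))).
  by rewrite ler_wpM2l// ge_min lexx orbT.
by rewrite mulrA ler_pdivrMr.
Qed.

(** Dividing by one more than the number of pieces makes the contradiction strict and covers an
    empty [J]. *)
Lemma pigeonhole_cover (I : eqType) (J : seq I) (U : I -> set 'rV[R]_d) F (m : R) :
  (forall x, F x -> exists2 i, i \in J & U i x) -> 0 < m -> mu F = m%:E ->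
  exists2 i, i \in J & ((m / (size J).+1%:R)%:E <= mu (F `&` U i))%E.
Proof.
move=> FJ m0 mF; apply: contrapT => H.
have {}H i : i \in J -> (mu (F `&` U i) <= (m / (size J).+1%:R)%:E)%E.
  move=> iJ; apply: contrapT => /negP; rewrite -ltNge => h; apply: H.
  by exists i => //; exact: ltW.
have S : (mu F <= \sum_(i <- J) mu (F `&` U i))%E.
  apply: (@le_trans _ _ (mu (F `&` [set x | exists2 i, i \in J & U i x]))).
    by apply: le_lebesgue_rV => x Fx; split => //; exact: FJ.
  elim: (J) => [|i J' IH].
    rewrite big_nil (_ : _ `&` _ = set0) ?measure0//.
    by apply/seteqP; split => x // [_ []].
  rewrite big_cons; apply: le_trans (leeD2l _ IH).
  apply: le_trans (lebesgue_rVU2 _ _).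
  apply: le_lebesgue_rV => x [Fx [j]]; rewrite inE => /predU1P[->|jJ] Ux.
    by left.
  by right; split => //; exists j.
have : (m%:E <= \sum_(i <- J) (m / (size J).+1%:R)%:E)%E.
  rewrite -mF (le_trans S)// big_seq [leRHS]big_seq; apply: lee_sum => i; exact: H.
rewrite sumEFin lee_fin big_const_seq count_predT iter_addr_0 leNgt.
apply/negP/negPn; rewrite -[_ *+ size J]mulr_natr mulrAC.
by rewrite ltr_pdivrMr// ltr_pM2l// ltr_nat ltnSn.
Qed.

Lemma separated_lower Omega N : (1 <= d)%N -> open Omega -> bounded_set Omega ->
  lipschitz_boundary Omega -> is_norm N ->
  exists c r0 : R, [/\ 0 < c, 0 < r0 &
    forall F r s, borel_rV F -> F `<=` Omega -> 0 < r <= r0 ->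
      mu F = (r ^+ d)%:E -> 0 < s <= 1 ->
      ((c * (r ^+ d * (s ^+ d * Num.min 1 (s / r))))%:E <=
       \int[mu]_x mu (xsection (separated Omega N F s) x))%E].
Proof.
move=> d1 oO bO lO NN.
have [J [U [z [eta [eta0 oU covU inner]]]]] := lipschitz_inner_cubes oO bO lO NN.
(* If n s >= k r, the directions that land in [F] have measure at most eta^d, which is at most half
   of (2 eta)^d since d >= 1. *)
pose k : R := 1 + eta^-1.
have k1 : 1 <= k by rewrite lerDl invr_ge0 ltW.
have k0 : 0 < k by exact: lt_le_trans k1.
pose cC : R := (2 * eta) ^+ d.
have cC0 : 0 < cC by rewrite exprn_gt0// mulr_gt0.
pose p : R := (size J).+1%:R.
have p0 : 0 < p by [].
(* The factors are half of the cube of directions, the share of the mass in one piece of the cover,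
   and the bound for 1 / n. The radius is limited so that 2 k r <= 1. *)
exists (cC / 2 / p / (2 * k)), (2 * k)^-1.
split; first by rewrite !divr_gt0// mulr_gt0.
  by rewrite invr_gt0 mulr_gt0.
move=> F r s bF FO /andP[r0 rle] mF s01; have /andP[s0 s1] := s01.
have kr : 2 * k * r <= 1 by rewrite mulrC -ler_pdivlMr ?mulr_gt0// mul1r.
have [n [n0 krn ns1 nmin]] := ex_dilation k1 r0 kr s01.
have rd0 : 0 < r ^+ d by rewrite exprn_gt0.
have [i iJ mFU] := pigeonhole_cover (fun x Fx => covU _ (FO _ Fx)) rd0 mF.
pose C := cube (z i) eta.
have inner' y w t : U i y -> Omega y -> C w -> 0 < t <= 1 ->
    Omega (y + t *: w) /\ N w < 1 by move=> *; exact: (inner i).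
have ne0 : (0 : R) < n%:R by rewrite ltr0n.
have ns0 : 0 < n%:R * s by rewrite mulr_gt0.
have bO' := borel_open oO; have bUi := borel_open (oU i).
have bC : borel_rV C := @borel_cube R d (z i) eta.
have mC : mu C = cC%:E by exact: lebesgue_rV_cube.
have half : (n%:R * s)^-1 ^+ d * r ^+ d <= cC / 2.
  rewrite exprVn mulrC ler_pdivrMr ?exprn_gt0//.
  have kr1 : eta^-1 * r <= n%:R * s.
    by apply: le_trans krn; rewrite ler_wpM2r ?ltW// /k ltr_pwDl.
  have : (eta^-1 * r) ^+ d <= (n%:R * s) ^+ d.
    by rewrite lerXn2r// nnegrE ltW// mulr_gt0// invr_gt0.
  rewrite exprMn exprVn mulrC ler_pdivrMr ?exprn_gt0// => h.
  apply: (le_trans h); rewrite /cC [(2 * eta) ^+ d]exprMn.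
  have two : (2 : R) <= 2 ^+ d.
    by rewrite -[leLHS]expr1 ler_eXn2l// ltr1n.
  rewrite [leRHS](_ : _ = (n%:R * s) ^+ d * eta ^+ d * (2 ^+ d / 2)); last by field.
  apply: ler_peMr; last by rewrite ler_pdivlMr// mul1r.
  by rewrite mulr_ge0// exprn_ge0// ltW.
have lo := displaced_lower bUi bF inner' ns0 ns1 FO mF mC.
have {}lo := lo (le_trans half _); rewrite ler_pdivrMr// in lo.
have {}lo := lo (ler_peMr (ltW cC0) (ler1n _ 2)).
have te := displaced_telescope bO' bUi bC bF inner' s0 ns1.
(* [inner] bounds N w only when a starting point is given; the positive measure of [F] in [U i]
   supplies one. *)
have CN w : C w -> N w < 1.
  have [x [Fx Ux]] : (F `&` U i) !=set0.
    apply/set0P/eqP => FU0; move: mFU; rewrite FU0 measure0 lee_fin.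
    by apply/negP; rewrite -ltNge divr_gt0.
  have H01 : 0 < (1 : R) <= 1 by rewrite ltr01 lexx.
  by move=> Cw; have [] := inner' _ _ _ Ux (FO _ Fx) Cw H01.
have ds := displaced_separated bO' bC NN bF s0 CN.
move: lo te ds; set A := (\int[mu]_x _)%E; set B := (\int[mu]_x _)%E => lo te ds.
apply: le_trans ds.
have sd0 : 0 < s ^+ d by rewrite exprn_gt0.
have {}lo : ((r ^+ d / p * (cC / 2))%:E <= A)%E.
  apply: le_trans lo; rewrite EFinM; apply: lee_pmul => //.
  - by rewrite lee_fin divr_ge0// ltW.
  - by rewrite lee_fin divr_ge0// ltW.
  - by rewrite lee_fin lerBrDr -lerBrDl (le_trans half)// lerBrDr -splitr.
have {te lo} : ((r ^+ d / p * (cC / 2) / n%:R)%:E <= B)%E.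
  by rewrite mulrC EFinM lee_pdivrMl// (le_trans lo).
rewrite -(@lee_pmul2l _ (s ^+ d)%:E) ?lte_fin// => /(le_trans _); apply.
rewrite -EFinM lee_fin.
have : Num.min 1 (s / r) / (2 * k) <= n%:R^-1.
  by rewrite ler_pdivrMr ?mulr_gt0// ler_pdivlMl.
set mn := Num.min _ _ => h.
have -> : cC / 2 / p / (2 * k) * (r ^+ d * (s ^+ d * mn)) =
  s ^+ d * (cC / 2 / p * (r ^+ d * (mn / (2 * k)))).
  by field; rewrite !gt_eqF.
rewrite ler_pM2l//.
have -> : r ^+ d / p * (cC / 2) / n%:R = cC / 2 / p * (r ^+ d / n%:R).
  by field; rewrite !gt_eqF.
by rewrite ler_pM2l ?divr_gt0// ler_pM2l.
Qed.

End separated_lower.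


(** * Dyadic levels and Euclidean balls *)

Section dyadic.
Context {R : realType}.
Implicit Types (b t : R).

(* The levels b * 2 ^ j, j in Z, enumerated by the natural numbers. *)
Definition level b (n : nat) : R :=
  if odd n then b / 2 ^+ (n./2).+1 else b * 2 ^+ n./2.

Lemma level_gt0 b n : 0 < b -> 0 < level b n.
Proof.
by move=> b0; rewrite /level; case: ifP => _; rewrite ?divr_gt0 ?mulr_gt0 ?exprn_gt0.
Qed.

Lemma ex_pow2 t : exists n : nat, t <= 2 ^+ n.
Proof.
exists (Num.truncn t).+1.
apply: (le_trans (ltW (truncnS_gt _))).
by rewrite -natrX ler_nat ltnW// ltn_expl.
Qed.

Lemma ex_level b t : 0 < b -> 0 < t ->
  exists n, level b n < t <= 2 * level b n.
Proof.
move=> b0 t_gt0; have [tb|bt] := leP t b.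
  have ex : exists k, b / 2 ^+ k.+1 < t.
    have [k hk] := ex_pow2 (b / t); exists k.
    rewrite ltr_pdivrMr ?exprn_gt0// mulrC -ltr_pdivrMr//.
    by rewrite (le_lt_trans hk)// ltr_eXn2l// ltr1n.
  case: (ex_minnP ex) => k hk kmin; exists k.*2.+1.
  rewrite /level /= odd_double uphalf_double /= hk /=.
  case: k kmin {hk} => [|k] kmin.
    by rewrite expr1 mulrC divfK.
  rewrite leNgt; apply/negP => h.
  have /kmin : b / 2 ^+ k.+1 < t; last by rewrite ltnn.
  move: h; rewrite exprS; congr (_ < _); field.
  by rewrite gt_eqF// exprn_gt0.
have ex : exists k, t <= b * 2 ^+ k.+1.
  have [k hk] := ex_pow2 (t / b); exists k.
  rewrite mulrC -ler_pdivrMr// (le_trans hk)// ler_eXn2l// ltr1n//.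
case: (ex_minnP ex) => k hk kmin; exists k.*2.
rewrite /level odd_double doubleK mulrCA -exprS hk andbT.
case: k kmin {hk} => [|k] kmin; first by rewrite expr0 mulr1.
rewrite ltNge; apply/negP => /kmin; by rewrite ltnn.
Qed.

Let gate (k x : R) : R := if x <= k then x else 0.

Let gate_ge0 k x : 0 <= x -> 0 <= gate k x.
Proof. by rewrite /gate; case: ifP. Qed.

(** The second bound of the minimum carries the induction: if b 2^M passes the gate, the earlier
    terms sum to at most b 2^M, and the total is at most twice that. *)
Let sum_up b (k : R) M : 0 < b -> 0 <= k ->
  \sum_(i < M) gate k (b * 2 ^+ i) <= Num.min (2 * k) (b * 2 ^+ M).
Proof.
move=> b0 k0; elim: M => [|M IH].
  by rewrite big_ord0 le_min mulr_ge0//= mulr_ge0 ?ltW// exprn_gt0.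
have p0 : 0 < b * 2 ^+ M by rewrite mulr_gt0// exprn_gt0.
rewrite big_ord_recr /= {2}/gate; move: IH; set S := \sum_(i < M) _.
rewrite !le_min exprS => /andP[h1 h2]; case: ifP => h; apply/andP; split; lra.
Qed.

Let sum_down b (k : R) M : 0 < b -> 0 <= k ->
  \sum_(i < M) gate k (b / 2 ^+ i.+1) <= Num.min (2 * k) b.
Proof.
move=> + k0; elim: M b => [|M IH] b b0.
  by rewrite big_ord0 le_min mulr_ge0//= ltW.
rewrite big_ord_recl /= expr1.
rewrite (eq_bigr (fun i : 'I_M => gate k (b / 2 / 2 ^+ i.+1))); last first.
  by move=> i _; congr gate; rewrite [in LHS]exprS invfM mulrA.
have b2 : 0 < b / 2 by rewrite divr_gt0.
have := IH _ b2; set S := \sum_(i < M) _.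
rewrite /gate !le_min => /andP[h1 h2]; case: ifP => h; apply/andP; split; lra.
Qed.

Let sum_level b (k : R) M : 0 < b -> 0 <= k -> \sum_(n < M) gate k (level b n) <= 4 * k.
Proof.
move=> b0 k0.
have E N : \sum_(n < N.*2) gate k (level b n) =
  \sum_(i < N) gate k (b * 2 ^+ i) + \sum_(i < N) gate k (b / 2 ^+ i.+1).
  elim: N => [|N IH]; first by rewrite !big_ord0 addr0.
  rewrite doubleS !big_ord_recr /= IH /level /= odd_double /= doubleK uphalf_double.
  by ring.
apply: (@le_trans _ _ (\sum_(n < M.*2) gate k (level b n))).
  rewrite -addnn big_split_ord /= lerDl sumr_ge0// => i _.
  by apply: gate_ge0; exact/ltW/level_gt0.
rewrite E; have := sum_up M b0 k0; have := sum_down M b0 k0.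
rewrite !le_min => /andP[h1 _] /andP[h2 _].
by apply: (le_trans (lerD h2 h1)); lra.
Qed.

Lemma nneseries_le_bound (u : nat -> \bar R) (x : \bar R) :
  (forall n, 0 <= u n)%E -> (forall M, \sum_(n < M) u n <= x)%E ->
  (\sum_(n <oo) u n <= x)%E.
Proof.
move=> u0 H; apply: lime_le; first exact: is_cvg_nneseries.
by apply: nearW => M; rewrite big_mkord.
Qed.

(** The geometric sum behind the dyadic layer-cake formula: taken at k = K z, it places the sum of
    the indicators of the superlevel sets, weighted by their levels, below 4 K. *)
Lemma sum_level_le b (k : \bar R) : 0 < b -> (0 <= k)%E ->
  (\sum_(n <oo) (if (level b n)%:E <= k then (level b n)%:E else 0) <= 4%:E * k)%E.
Proof.
move=> b0; case: k => [k k0|_|//]; last first.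
  by rewrite mulry gtr0_sg// mul1e leey.
apply: nneseries_le_bound => [n|M].
  by case: ifP => // _; rewrite lee_fin ltW// level_gt0.
rewrite -EFinM (eq_bigr (fun n : 'I_M => (gate k (level b n))%:E)).
  by rewrite sumEFin lee_fin sum_level.
by move=> n _; rewrite /gate lee_fin; case: ifP.
Qed.

End dyadic.

Section euclidean_norm.
Context {R : realType} {d : nat}.
Local Notation T := (lebesgue_type R d).
Local Notation mu := (@lebesgue_rV R d).
Implicit Types (x y : 'rV[R]_d).

Let dot x y : R := \sum_i x ord0 i * y ord0 i.

Let enormE x : enorm x ^+ 2 = \sum_i x ord0 i ^+ 2.
Proof. by rewrite sqr_sqrtr// sumr_ge0// => i _; exact: sqr_ge0. Qed.

Let enorm_ge0 x : 0 <= enorm x. Proof. exact: sqrtr_ge0. Qed.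

Let enorm_eq0 x : enorm x = 0 -> x = 0.
Proof.
move=> x0; have := enormE x; rewrite x0 expr0n /= => /esym/eqP.
rewrite psumr_eq0; last by move=> i _; exact: sqr_ge0.
move=> /allP H; apply/rowP => i; rewrite mxE; apply/eqP.
by rewrite -(sqrf_eq0 (x ord0 i)); apply: H; rewrite mem_index_enum.
Qed.

Let cauchy_schwarz x y : dot x y <= enorm x * enorm y.
Proof.
have [x0|x0] := eqVneq (enorm x) 0.
  by rewrite x0 mul0r /dot (enorm_eq0 x0) big1// => i _; rewrite mxE mul0r.
have [y0|y0] := eqVneq (enorm y) 0.
  by rewrite y0 mulr0 /dot (enorm_eq0 y0) big1// => i _; rewrite mxE mulr0.
set X := enorm x in x0 *; set Y := enorm y in y0 *.
have XY0 : 0 < X * Y by rewrite mulr_gt0// lt_def ?x0 ?y0 enorm_ge0.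
(* Expanded, this sum is 2 X Y (X Y - dot x y), and X Y > 0. *)
have : 0 <= \sum_i (Y * x ord0 i - X * y ord0 i) ^+ 2.
  by apply: sumr_ge0 => i _; exact: sqr_ge0.
have -> : \sum_i (Y * x ord0 i - X * y ord0 i) ^+ 2 =
  Y ^+ 2 * (X ^+ 2) + X ^+ 2 * (Y ^+ 2) - 2 * (X * Y) * dot x y.
  rewrite [X in _ * X + _ - _]enormE [X in _ + _ * X - _]enormE.
  rewrite /dot !mulr_sumr -big_split -sumrB /=; apply: eq_bigr => i _; ring.
have -> : Y ^+ 2 * X ^+ 2 + X ^+ 2 * Y ^+ 2 - 2 * (X * Y) * dot x y =
  2 * (X * Y) * (X * Y - dot x y) by ring.
have XY2 : 0 < 2 * (X * Y) by rewrite mulr_gt0.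
by rewrite (pmulr_rge0 _ XY2) subr_ge0.
Qed.

Lemma enorm_is_norm : is_norm (@enorm R d).
Proof.
split => //.
  move=> a x; rewrite /enorm.
  rewrite (eq_bigr (fun i => a ^+ 2 * x ord0 i ^+ 2)); last first.
    by move=> i _; rewrite mxE exprMn.
  by rewrite -mulr_sumr sqrtrM ?sqr_ge0// sqrtr_sqr.
move=> x y; rewrite -(@ler_pXn2r _ 2)// ?nnegrE ?addr_ge0//.
rewrite sqrrD !enormE.
have -> : \sum_i (x + y) ord0 i ^+ 2 =
  \sum_i x ord0 i ^+ 2 + dot x y *+ 2 + \sum_i y ord0 i ^+ 2.
  rewrite /dot -sumrMnl -!big_split /=; apply: eq_bigr => i _.
  by rewrite mxE sqrrD.
by rewrite lerD2r lerD2l lerMn2r cauchy_schwarz orbT.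
Qed.

Lemma borel_norm_lt (N : 'rV[R]_d -> R) (r : R) : is_norm N ->
  borel_rV [set x | N x < r].
Proof. by move=> NN; apply: borel_open; exact: is_norm_open. Qed.

Lemma borel_eball (r : R) : borel_rV (eball r : set 'rV[R]_d).
Proof. exact: borel_norm_lt enorm_is_norm. Qed.

Lemma norm_ball_measure (N : 'rV[R]_d -> R) (r : R) : is_norm N -> 0 < r ->
  mu [set x | N x < r] = ((r ^+ d)%:E * mu [set x | (N x < 1)%R])%E.
Proof.
move=> [_ _ NZ _] r0; have ri : 0 < r^-1 by rewrite invr_gt0.
rewrite -[X in X ^+ d]invrK -(lebesgue_rV_affine 0 _ ri); congr (mu _).
apply/funext => x; rewrite /mkset addr0 NZ gtr0_norm// mulrC.
by rewrite ltr_pdivrMr// mul1r.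
Qed.

Lemma eball1_measure : exists2 w : R, 0 < w & mu (eball 1 : set 'rV[R]_d) = w%:E.
Proof.
have d0 : (0 : R) < d%:R + 1 by rewrite ltr_pwDr.
pose e : R := (d%:R + 1)^-1.
have e0 : 0 < e by rewrite invr_gt0.
have sub1 : cube 0 e `<=` (eball 1 : set 'rV[R]_d).
  move=> x xe; rewrite /eball /=.
  apply: (le_lt_trans (enorm_le_coord (ltW e0) (x := x) _)).
    by move=> i; have := xe i; rewrite mxE subr0 => /ltW.
  by rewrite ltr_pdivrMr// mul1r ltrDl.
have sub2 : (eball 1 : set 'rV[R]_d) `<=` cube 0 1.
  move=> x x1 i; rewrite mxE subr0 (le_lt_trans _ x1)//.
  rewrite -sqrtr_sqr; apply: ler_wsqrtr; rewrite (bigD1 i)//= lerDl.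
  by apply: sumr_ge0 => j _; exact: sqr_ge0.
have fin : mu (eball 1 : set 'rV[R]_d) \is a fin_num.
  rewrite ge0_fin_numE// (le_lt_trans (le_lebesgue_rV sub2))//.
  by rewrite lebesgue_rV_cube// ltry.
exists (fine (mu (eball 1 : set 'rV[R]_d))); last by rewrite fineK.
rewrite -lte_fin fineK// (lt_le_trans _ (le_lebesgue_rV sub1))//.
by rewrite lebesgue_rV_cube// lte_fin exprn_gt0// mulr_gt0.
Qed.

End euclidean_norm.


Section integral_bound.
Local Open Scope ereal_scope.
Context d (T : measurableType d) (R : realType).
Variable mu : {measure set T -> \bar R}.

Lemma integral_le_cst (A : set T) (f : T -> \bar R) (c : R) : measurable A ->
  (forall x, 0 <= f x) -> (forall x, A x -> f x <= c%:E) ->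
  (forall x, ~ A x -> f x = 0) -> \int[mu]_x f x <= c%:E * mu A.
Proof.
move=> mA f0 fA fnA; rewrite -integral_cst// [leRHS]integral_mkcond.
apply: le_integral_nonneg => // x _; rewrite patchE; case: ifPn.
  by rewrite inE => /fA.
by rewrite notin_setE => /fnA ->.
Qed.

End integral_bound.

Section balls.
Context {R : realType} {d : nat}.
Local Notation T := (lebesgue_type R d).
Local Notation mu := (@lebesgue_rV R d).
Local Notation eball := (@eball R d).
Implicit Types (x y : 'rV[R]_d) (r S : R).

Definition omega : R := fine (mu (eball 1)).

Lemma omega_gt0 : 0 < omega.
Proof. by rewrite /omega; have [w w0 ->] := @eball1_measure R d. Qed.

Lemma eball_measure r : (0 < d)%N -> 0 <= r -> mu (eball r) = (omega * r ^+ d)%:E.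
Proof.
move=> d0; rewrite le_eqVlt => /predU1P[<-|r0].
  rewrite expr0n (gtn_eqF d0) mulr0 (_ : eball 0 = set0) ?measure0//.
  apply/seteqP; split => x //; rewrite /eball /= ltNge.
  by move/negP; apply; have [+ _ _ _] := @enorm_is_norm R d; apply.
rewrite (norm_ball_measure enorm_is_norm r0) mulrC EFinM /omega.
by have [w w0 E] := @eball1_measure R d; rewrite [in RHS]E /= -E.
Qed.

Lemma ex_radius (m : R) : (0 < d)%N -> 0 <= m ->
  exists2 r : R, 0 <= r & omega * r ^+ d = m.
Proof.
move=> d0 m0; exists ((m / omega) `^ d%:R^-1); first exact: powR_ge0.
have mo : 0 <= m / omega by rewrite divr_ge0// ltW// omega_gt0.
rewrite -powR_mulrn ?powR_ge0// -powRrM mulVf ?pnatr_eq0 -?lt0n// powRr1//.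
by rewrite mulrC divfK// gt_eqF// omega_gt0.
Qed.

Lemma radius_inj r S : (0 < d)%N -> 0 <= r -> 0 <= S ->
  omega * r ^+ d = omega * S ^+ d -> r = S.
Proof.
move=> d0 r0 S0 /(mulfI (lt0r_neq0 omega_gt0)) /eqP.
by rewrite eqrXn2// => /eqP.
Qed.

Lemma ball_of_measureE (m : R) : (0 < d)%N -> 0 <= m ->
  exists r, [/\ 0 <= r, omega * r ^+ d = m & ball_of_measure m = eball r].
Proof.
move=> d0 m0; rewrite /ball_of_measure.
have [s s0 sm] := ex_radius d0 m0.
have /xgetPex : exists r, [set r : R | 0 <= r /\ mu (eball r) = m%:E] r.
  by exists s; split => //; rewrite eball_measure// sm.
move=> /(_ 0); set r := xget _ _ => -[r0 rm].
by exists r; split => //; move: rm; rewrite eball_measure// => -[].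
Qed.

(** With t = S / r this controls the measure of the shell between the radii r - S and r + S. *)
Lemma pow_shell (t : R) n : 0 <= t <= 1 ->
  (1 + t) ^+ n - (1 - t) ^+ n <= (n * 2 ^ n)%:R * t.
Proof.
move=> /andP[t0 t1]; elim: n => [|n IH]; first by rewrite !expr0 subrr mul0n mul0r.
have -> : (1 + t) ^+ n.+1 - (1 - t) ^+ n.+1 =
  (1 + t) * ((1 + t) ^+ n - (1 - t) ^+ n) + 2 * t * (1 - t) ^+ n.
  by rewrite !exprS; ring.
have p1 : (1 - t) ^+ n <= 1 by rewrite exprn_ile1 ?subr_ge0// gerBl.
have h1 : (1 + t) * ((1 + t) ^+ n - (1 - t) ^+ n) <= 2 * ((n * 2 ^ n)%:R * t).
  apply: ler_pM => //; first by rewrite addr_ge0.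
    rewrite subr_ge0 lerXn2r ?nnegrE ?subr_ge0 ?addr_ge0//.
    by rewrite lerD2l ge0_cp.
  by rewrite lerD2l.
have h2 : 2 * t * (1 - t) ^+ n <= 2 * t by rewrite ler_piMr ?mulr_ge0.
have h3 : 2 * t <= (2 ^ n.+1)%:R * t.
  by rewrite ler_wpM2r// ler_nat expnS leq_pmulr// expn_gt0.
rewrite [X in _ <= X](_ : _ = 2 * ((n * 2 ^ n)%:R * t) + (2 ^ n.+1)%:R * t).
  by rewrite lerD// (le_trans h2).
by rewrite !expnS !natrM -natr1; ring.
Qed.

(** In [ball_separated_le] the summand d 2^d serves the thin shells, S <= r, and 2^d + 1 the case S
    > r. *)
Definition Cd : R := (d * 2 ^ d + 2 ^ d + 1)%:R.

Lemma Cd_gt0 : 0 < Cd. Proof. by rewrite ltr0n addn1. Qed.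

(** If S <= r, the first point of a separated pair lies in the shell of half-width S about the
    sphere, and its partner in a ball of radius S. If S > r, it is enough that one of the two points
    lies in the ball. *)
Lemma ball_separated_le r S : (0 < d)%N -> 0 < r -> 0 <= S ->
  (\int[mu]_x mu (xsection (separated setT (@enorm R d) (eball r) S) x) <=
   (Cd * (omega * r ^+ d) * (omega * S ^+ d * Num.min 1 (S / r)))%:E)%E.
Proof.
move=> d0 r0 S0.
have NN := @enorm_is_norm R d; have [N0 _ _ ND] := NN.
have NB x y : enorm (x - y) = enorm (y - x) by rewrite -opprB is_normN.
have w0 := omega_gt0.
have rd0 : 0 < r ^+ d by rewrite exprn_gt0.
have Sd0 : 0 <= S ^+ d by rewrite exprn_ge0.
have sec x : (mu (xsection (separated setT (@enorm R d) (eball r) S) x) <=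
    (omega * S ^+ d)%:E)%E.
  rewrite -eball_measure// -(lebesgue_rV_shift (- x) (eball S)).
  apply: le_lebesgue_rV => y; rewrite /xsection /= inE => -[_ _ /= h _].
  by rewrite NB in h; exact: h.
have [Sr|rS] := leP S r.
  have t01 : 0 <= S / r <= 1.
    by rewrite divr_ge0 ?(ltW r0)//= ler_pdivrMr// mul1r.
  rewrite (_ : Num.min 1 (S / r) = S / r); last by case/andP: t01 => _ /min_idPr.
  pose A : set T := eball (r + S) `\` eball (r - S).
  have mA : measurable A.
    by apply: measurableD; apply: borel_measurable; exact: borel_eball.
  apply: (@le_trans _ _ ((omega * S ^+ d)%:E * mu A)%E).
    apply: integral_le_cst => // x nA.
    rewrite (_ : xsection _ _ = set0) ?measure0//; apply/seteqP; split => // y.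
    move=> Hy; have {Hy}[_ _ /= xy neq] := set_mem Hy.
    apply: nA; split; rewrite /eball /=.
      move: neq; case: (boolP (x \in eball r)) => [|_].
        by rewrite inE => xr _; rewrite (lt_le_trans xr)// lerDl.
      rewrite eq_sym eqbF_neg negbK inE => yr.
      by rewrite -(subrK y x) (le_lt_trans (ND _ _))// addrC ltrD.
    move=> xr; have xB : x \in eball r.
      by rewrite inE /eball /= (lt_le_trans xr)// gerBl.
    move: neq; rewrite xB eq_sym eqb_id => /negP; apply; rewrite inE /eball /=.
    rewrite -(subrK x y) (le_lt_trans (ND _ _))// -NB -(subrK S r) addrC ltrD//.
  have -> : mu A = (omega * (r + S) ^+ d - omega * (r - S) ^+ d)%:E.
    have mE s : measurable (eball s : set T).
      by apply: borel_measurable; exact: borel_eball.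
    transitivity (mu (eball (r + S)) - mu (eball (r + S) `&` eball (r - S)))%E.
      apply: measureD => //.
      by rewrite [ltLHS]eball_measure ?addr_ge0 ?(ltW r0)// ltry.
    rewrite setIidr; last first.
      move=> x /= h; rewrite /eball /= (lt_le_trans h)// lerD2l.
      by rewrite ge0_cp.
    by rewrite !eball_measure ?subr_ge0 ?addr_ge0 ?(ltW r0).
  have shell : (r + S) ^+ d - (r - S) ^+ d <= Cd * r ^+ d * (S / r).
    have -> : r + S = r * (1 + S / r) by field; rewrite gt_eqF.
    have -> : r - S = r * (1 - S / r) by field; rewrite gt_eqF.
    rewrite !exprMn -mulrBr mulrAC mulrC ler_pM2r//.
    rewrite (le_trans (pow_shell _ t01))// ler_wpM2r//; first by case/andP: t01.
    by rewrite ler_nat -addnA leq_addr.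
  rewrite -EFinM lee_fin -mulrBr.
  rewrite [leRHS](_ : _ = omega * S ^+ d * (omega * (Cd * r ^+ d * (S / r)))); last by ring.
  by rewrite ler_wpM2l ?mulr_ge0 ?(ltW w0)// ler_pM2l.
have -> : Num.min 1 (S / r) = 1.
  by apply/min_idPl; rewrite ler_pdivlMr// mul1r ltW.
have mE s : measurable (eball s : set T).
  by apply: borel_measurable; exact: borel_eball.
(* [f1] accounts for the pairs with x in the ball, [f2] for those with y in it and x outside; then x
   has norm below r + S < 2 S. *)
pose f1 := (cst (omega * S ^+ d)%:E \_ (eball r : set T)) : T -> \bar R.
pose f2 := (cst (omega * r ^+ d)%:E \_ (eball (2 * S) : set T)) : T -> \bar R.
have c0 (b : R) : 0 <= b -> (0 <= (omega * b)%:E)%E.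
  by move=> b0; rewrite lee_fin mulr_ge0// ltW.
have f10 x : (0 <= f1 x)%E by apply: erestrict_ge0 => y _; exact: c0.
have f20 x : (0 <= f2 x)%E by apply: erestrict_ge0 => y _; apply: c0 => //; exact: ltW.
have mf1 : measurable_fun setT f1 by apply/(measurable_restrictT _ (mE _)).1.
have mf2 : measurable_fun setT f2 by apply/(measurable_restrictT _ (mE _)).1.
apply: (@le_trans _ _ (\int[mu]_x (f1 x + f2 x))%E).
  apply: le_integral_nonneg => // x _.
  case: (boolP (x \in (eball r : set T))) => xr.
    rewrite /f1 patchE xr /= (le_trans (sec x))// leeDl//.
  rewrite /f1 /f2 !patchE (negbTE xr) add0e; case: ifPn => x2S.
    rewrite -eball_measure// ?(ltW r0)//; apply: le_lebesgue_rV => y.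
    move=> Hy; have {Hy}[_ _ /= xy] := set_mem Hy.
    rewrite [X in X != _](_ : _ = false); last exact/negbTE.
    by rewrite eq_sym eqbF_neg negbK inE.
  rewrite (_ : xsection _ _ = set0) ?measure0//; apply/seteqP; split => // y.
  move=> Hy; have {Hy}[_ _ /= xy] := set_mem Hy.
  rewrite [X in X != _](_ : _ = false); last exact/negbTE.
  rewrite eq_sym eqbF_neg negbK inE => yr.
  move/negP : x2S; apply; rewrite inE /eball /= -(subrK y x).
  rewrite (le_lt_trans (ND _ _))// mulr_natl mulr2n ltrD//.
  by rewrite (lt_trans yr).
rewrite ge0_integralD// -!integral_mkcond !integral_cst//.
rewrite [X in (_ * X + _ <= _)%E]eball_measure ?(ltW r0)//.
rewrite [X in (_ + _ * X <= _)%E]eball_measure ?mulr_ge0//.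
rewrite -!EFinM -EFinD lee_fin exprMn mulr1.
rewrite [leLHS](_ : _ = (2 ^+ d + 1) * (omega * r ^+ d) * (omega * S ^+ d)); last by ring.
rewrite ler_wpM2r ?mulr_ge0 ?(ltW w0)// ler_wpM2r ?mulr_ge0 ?(ltW w0) ?(ltW rd0)//.
by rewrite -natrX natr1 -[X in X <= _]/(_%:R) ler_nat -addn1 -addnA leq_addl.
Qed.

End balls.
Arguments omega R d : clear implicits.
Arguments Cd R d : clear implicits.


(** * Perimeters of balls for the rearranged kernel *)

Section series_integrals.
Local Open Scope ereal_scope.
Context {R : realType} {d : nat}.
Local Notation T := (lebesgue_type R d).
Local Notation mu := (@lebesgue_rV R d).

Lemma le_series (u v : nat -> \bar R) : (forall n, 0 <= u n) ->
  (forall n, u n <= v n) -> \sum_(n <oo) u n <= \sum_(n <oo) v n.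
Proof. by move=> u0 uv; apply: lee_nneseries => // n _. Qed.

Lemma integral_series (f : nat -> T -> \bar R) :
  (forall n, measurable_fun setT (f n)) -> (forall n x, 0 <= f n x) ->
  \int[mu]_x \sum_(n <oo) f n x = \sum_(n <oo) \int[mu]_x f n x.
Proof.
by move=> mf f0; apply: (@integral_nneseries _ T R mu setT measurableT f) => // n x _.
Qed.

Lemma integralZl_lebesgue (f : T -> \bar R) (k : R) : measurable_fun setT f ->
  (forall x, 0 <= f x) -> (0 <= k)%R ->
  \int[mu]_x (k%:E * f x) = k%:E * \int[mu]_x f x.
Proof.
move=> mf f0 k0.
by apply: (@ge0_integralZl_EFin _ T R mu setT measurableT f _ mf _ k0) => x _.
Qed.

Lemma integralZ_indic (A : set T) (k : R) : measurable A -> (0 <= k)%R ->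
  \int[mu]_x (k%:E * (\1_A x)%:E) = k%:E * mu A.
Proof.
move=> mA k0.
rewrite (integralZl_lebesgue (f := fun x => (\1_A x)%:E))//.
  by rewrite (@integral_indic _ T R mu setT measurableT A mA) setIT.
by apply/measurable_EFinP; exact: measurable_indic.
Qed.

Lemma integral2_series (l : nat -> R) (A : nat -> set (T * T)) :
  (forall n, (0 <= l n)%R) -> (forall n, measurable (A n)) ->
  \int[mu]_x \int[mu]_y (\sum_(n <oo) (l n)%:E * (\1_(A n) (x, y))%:E) =
  \sum_(n <oo) (l n)%:E * \int[mu]_x mu (xsection (A n) x).
Proof.
move=> l0 mA.
transitivity (\int[mu]_x \sum_(n <oo) (l n)%:E * mu (xsection (A n) x)).
  apply: eq_integral => x _.
  have mI n : measurable_fun (setT : set T) (fun y : T => (\1_(xsection (A n) x) y : R)%:E).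
    apply/measurable_EFinP; apply: measurable_indic.
    by apply: measurable_xsection; exact: mA.
  transitivity (\int[mu]_y \sum_(n <oo) (l n)%:E * (\1_(xsection (A n) x) y)%:E).
    apply: eq_integral => y _; apply: eq_eseriesr => n _.
    by rewrite !indicE mem_xsection.
  rewrite (integral_series (f := fun n y => (l n)%:E * (\1_(xsection (A n) x) y)%:E)).
  - apply: eq_eseriesr => n _; apply: integralZ_indic => //.
    by apply: measurable_xsection; exact: mA.
  - by move=> n; apply: measurable_funeM; exact: mI.
  - by move=> n y; rewrite mule_ge0// lee_fin.
rewrite (integral_series (f := fun n x => (l n)%:E * mu (xsection (A n) x))).
- by apply: eq_eseriesr => n _; apply: integralZl_xsection.
- by move=> n; apply: measurable_funeM; exact: (measurable_fun_xsection mu (mA n)).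
- by move=> n y; rewrite mule_ge0// lee_fin.
Qed.

End series_integrals.

Section perimeter_ball.
Context {R : realType} {d : nat}.
Local Notation T := (lebesgue_type R d).
Local Notation mu := (@lebesgue_rV R d).
Implicit Types (J : 'rV[R]_d -> \bar R) (l rad : nat -> R).

Lemma interaction_set0 J (E A : set 'rV[R]_d) : interaction J E A set0 = 0%E.
Proof.
rewrite /interaction; apply: integral0_eq => x _.
by rewrite integral_set0.
Qed.

Lemma perimeter_ball_le J l rad r : (0 < d)%N ->
  (forall x, 0 <= J x)%E -> (forall n, 0 <= l n) -> (forall n, 0 <= rad n) ->
  (forall x, (J x <= \sum_(n <oo) (l n)%:E * (\1_(eball (rad n)) x)%:E)%E) ->
  0 < r ->
  (perimeter J (eball r) <= (Cd R d * (omega R d * r ^+ d))%:E *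
    \sum_(n <oo) (l n * (omega R d * rad n ^+ d * Num.min 1 (rad n / r)))%:E)%E.
Proof.
move=> d0 J0 l0 rad0 Jle r0.
rewrite /perimeter /perimeter_in setCT interaction_set0 adde0.
pose A n := separated setT (@enorm R d) (eball r) (rad n).
have mA n : measurable (A n).
  apply: measurable_separated; [exact: borel_open openT|exact: enorm_is_norm|].
  exact: borel_eball.
have I0 : (0 <= interaction J (eball r) setT setT)%E.
  by apply: integral_ge0 => x _; apply: integral_ge0 => y _; rewrite mule_ge0.
apply: (@le_trans _ _ (interaction J (eball r) setT setT)).
  rewrite -[leRHS]mul1e lee_wpmul2r// lee_fin invf_le1//; exact: ler1n.
have cd0 : 0 <= Cd R d * (omega R d * r ^+ d).
  by rewrite mulr_ge0 ?(ltW Cd_gt0)// mulr_ge0 ?exprn_ge0 ?(ltW omega_gt0) ?ltW.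
have t0 n : 0 <= l n * (omega R d * rad n ^+ d * Num.min 1 (rad n / r)).
  rewrite mulr_ge0// mulr_ge0 ?mulr_ge0 ?exprn_ge0 ?(ltW omega_gt0)//.
  by rewrite le_min ler01 divr_ge0// ltW.
rewrite -nneseriesZl; last by move=> n _; rewrite lee_fin.
apply: (@le_trans _ _
  (\int[mu]_x \int[mu]_y (\sum_(n <oo) (l n)%:E * (\1_(A n) (x, y))%:E))%E).
  apply: le_integral_nonneg => x _.
    by apply: integral_ge0 => y _; rewrite mule_ge0.
  apply: le_integral_nonneg => y _; first by rewrite mule_ge0.
  have S0 : (0 <= \sum_(n <oo) (l n)%:E * (\1_(A n) (x, y))%:E)%E.
    by apply: nneseries_ge0 => n _ _; rewrite mule_ge0// lee_fin.
  rewrite !indicE; have [<-|neq] := eqVneq ((x : 'rV[R]_d) \in eball r) (y \in eball r).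
    by rewrite subrr normr0 mul0e.
  have -> : `|(x \in eball r)%:R - (y \in eball r)%:R| = 1 :> R.
    by move: neq; case: (_ \in _); case: (_ \in _) => //= _;
      rewrite ?subr0 ?sub0r ?normrN ?normr1.
  rewrite mul1e (le_trans (Jle _))//; apply: le_series => n.
    by rewrite mule_ge0// lee_fin.
  rewrite lee_wpmul2l ?lee_fin// !indicE.
  case: (boolP (_ \in eball (rad n))) => //; rewrite inE => h.
  by rewrite mem_set.
rewrite integral2_series//; apply: le_series => n.
  by rewrite mule_ge0 ?lee_fin// integral_ge0.
rewrite -EFinM mulrCA EFinM lee_wpmul2l ?lee_fin//.
exact: ball_separated_le.
Qed.

End perimeter_ball.

Section rearranged_kernel.
Context {R : realType} {d : nat}.
Local Notation T := (lebesgue_type R d).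
Local Notation mu := (@lebesgue_rV R d).
Local Notation leb := (@lebesgue_measure R).
Variables (K : 'rV[R]_d -> \bar R).
Hypotheses (d_gt0 : (0 < d)%N) (mK : measurable_fun (setT : set T) K).
Hypothesis K0 : forall x, (0 <= K x)%E.
Hypothesis K_moment :
  (\int[mu]_z (K z * (Num.min 1%R (enorm z))%:E) < +oo)%E.

Definition superlevel (t : R) : set 'rV[R]_d := [set x | (t%:E < K x)%E].

Lemma measurable_superlevel t : measurable (superlevel t : set T).
Proof.
by rewrite -[X in measurable X]setTI; exact: emeasurable_fun_o_infty.
Qed.

Lemma min1_enorm_ge0 (z : 'rV[R]_d) (r : R) : 0 <= r ->
  0 <= Num.min r (enorm z).
Proof. by move=> r0; rewrite le_min r0; case: (@enorm_is_norm R d) => ->. Qed.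

(** Chebyshev's inequality outside the unit ball, where the weight min(1, |z|) is 1. Finiteness
    makes [set_rearrangement] meaningful at every positive level. *)
Lemma superlevel_finite t : 0 < t -> (mu (superlevel t) < +oo)%E.
Proof.
move=> t0.
pose A : set T := superlevel t `\` eball 1.
have mA : measurable A.
  apply: measurableD; first exact: measurable_superlevel.
  by apply: borel_measurable; exact: borel_eball.
have A_fin : (mu A < +oo)%E.
  have : (t%:E * mu A < +oo)%E.
    apply: le_lt_trans K_moment; rewrite -integral_cst//.
    apply: (@le_trans _ _ (\int[mu]_(z in A) (K z * (Num.min 1%R (enorm z))%:E))%E).
      apply: le_integral_nonneg => [x _|x [tK]]; first by rewrite lee_fin ltW.
      rewrite /eball /= => /negP; rewrite -leNgt => /min_idPl ->.
      by rewrite mule1 ltW.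
    apply: subset_integral_nonneg => // x _.
    by rewrite mule_ge0// lee_fin min1_enorm_ge0.
  by rewrite !ltey; apply: contra => /eqP ->; rewrite gt0_muley// lte_fin.
apply: (@le_lt_trans _ _ (mu (A `|` eball 1))).
  apply: le_lebesgue_rV => x h; have [|] := pselect (eball 1 x); first by right.
  by left.
apply: le_lt_trans (lebesgue_rVU2 _ _) _.
rewrite lte_add_pinfty//.
by rewrite [ltLHS]eball_measure// ltry.
Qed.

Lemma superlevel_radius t : 0 < t -> exists r, [/\ 0 <= r,
  mu (superlevel t) = (omega R d * r ^+ d)%:E &
  set_rearrangement (superlevel t) = eball r].
Proof.
move=> t0; have fin : mu (superlevel t) \is a fin_num.
  by rewrite ge0_fin_numE// superlevel_finite.
have [|r [r0 rm rE]] := @ball_of_measureE R d (fine (mu (superlevel t))) d_gt0.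
  exact: fine_ge0.
by exists r; split => //; rewrite rm fineK.
Qed.

(** For t between [level b n] and its double, the superlevel set at t is contained in the one at
    [level b n], so its rearrangement lies in the ball of radius [rad n]. The interval of such t has
    length [level b n]. *)
Lemma rearrangement_le (b : R) (rad : nat -> R) x : 0 < b ->
  (forall n, 0 <= rad n) ->
  (forall n, mu (superlevel (level b n)) = (omega R d * rad n ^+ d)%:E) ->
  (rearrangement K x <=
     \sum_(n <oo) (level b n)%:E * (\1_(eball (rad n)) x)%:E)%E.
Proof.
move=> b0 rad0 radE; rewrite /rearrangement.
pose I n : set (measurableTypeR R) := `](level b n), (2 * level b n)]%classic.
have mI n : measurable (I n) by exact: measurable_itv.
pose D : set (measurableTypeR R) := `]0%R, +oo[%classic.
have mD : measurable D by exact: measurable_itv.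
apply: (@le_trans _ _ (\int[leb]_(t in D)
   (\sum_(n <oo) ((\1_(eball (rad n)) x)%:E * (\1_(I n) t)%:E)))%E).
  apply: le_integral_nonneg => t; first by rewrite lee_fin.
  rewrite /D /= in_itv/= andbT => t0.
  pose u k : \bar R := ((\1_(eball (rad k)) x)%:E * (\1_(I k) t)%:E)%E.
  have u0 k : (0 <= u k)%E by rewrite mule_ge0// lee_fin.
  have S0 : (0 <= \sum_(n <oo) u n)%E by exact: nneseries_ge0.
  have [r [r0 rE ->]] := superlevel_radius t0.
  rewrite indicE; case: (boolP (_ \in _)) => //; rewrite inE => xr.
  have [n /andP[n1 n2]] := ex_level b0 t0.
  have rn : r <= rad n.
    have : (mu (superlevel t) <= mu (superlevel (level b n)))%E.
      by apply: le_lebesgue_rV => y; apply: lt_trans; rewrite lte_fin.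
    by rewrite rE radE lee_fin ler_pM2l ?omega_gt0// ler_pXn2r ?nnegrE.
  apply: (@le_trans _ _ ((\1_(eball (rad n)) x)%:E * (\1_(I n) t)%:E)%E).
    rewrite !indicE !mem_set ?mule1//; first by rewrite /I /= in_itv/= n1 n2.
    exact: lt_le_trans xr rn.
  rewrite (@nneseriesD1 _ u n xpredT)//.
  by rewrite leeDl// nneseries_ge0.
rewrite integral_nneseries//; last first.
  move=> n; apply: measurable_funeM; apply/measurable_EFinP.
  by apply: measurable_indic.
apply: le_series => n.
  by apply: integral_ge0 => t _; rewrite mule_ge0// lee_fin.
rewrite ge0_integralZl_EFin//; last by apply/measurable_EFinP; apply: measurable_indic.
rewrite integral_indic// muleC lee_wpmul2r ?lee_fin//.
apply: (@le_trans _ _ (leb (I n))).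
  by apply: le_measure; rewrite ?inE//; exact: measurableI.
rewrite /I lebesgue_measure_itv/= lte_fin; have l0 := level_gt0 n b0.
by rewrite ifT; [rewrite -EFinB lee_fin; lra|lra].
Qed.

End rearranged_kernel.


(** * Level sums and the moment of the kernel *)

Section bathtub.
Context {R : realType} {d : nat}.
Local Notation T := (lebesgue_type R d).
Local Notation mu := (@lebesgue_rV R d).

Lemma measurable_enorm :
  measurable_fun setT ((fun x => enorm x) : T -> measurableTypeR R).
Proof.
apply: (measurability _ (RGenInftyO.measurableE R)) => _ [_ [r ->] <-].
rewrite setTI; apply: borel_measurable.
rewrite (_ : _ @^-1` _ = eball r); first exact: borel_eball.
by apply/seteqP; split => x; rewrite /eball /= in_itv.
Qed.

Lemma measurable_min_enorm (r : R) :
  measurable_fun setT ((fun x => (Num.min r (enorm x))%:E) : T -> \bar R).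
Proof.
apply/measurable_EFinP; apply: measurable_minr.
  exact: measurable_cst.
exact: measurable_enorm.
Qed.

(* Half of the mass of A lies outside the ball of half the radius. *)
Lemma bathtub (A : set 'rV[R]_d) (rad r : R) : (0 < d)%N ->
  measurable (A : set T) -> 0 <= rad -> mu A = (omega R d * rad ^+ d)%:E ->
  0 <= r ->
  ((omega R d * rad ^+ d * Num.min r rad)%:E <=
    4%:E * \int[mu]_(z in A) (Num.min r (enorm z))%:E)%E.
Proof.
move=> d0 mA rad0 muA r0.
have w0 := @omega_gt0 R d.
have rd0 : 0 <= rad ^+ d by rewrite exprn_ge0.
pose A' : set T := A `\` eball (rad / 2).
have mB : measurable (eball (rad / 2) : set T).
  by apply: borel_measurable; exact: borel_eball.
have mA' : measurable A' by exact: measurableD.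
have muA' : ((omega R d * rad ^+ d / 2)%:E <= mu A')%E.
  have : (mu A <= mu (eball (rad / 2) : set 'rV[R]_d) + mu A')%E.
    apply: le_trans (lebesgue_rVU2 _ _).
    apply: le_lebesgue_rV => x Ax; have [|] := pselect (eball (rad / 2) x).
      by left.
    by right.
  rewrite muA [X in (_ <= X + _)%E]eball_measure ?divr_ge0//.
  rewrite -leeBlDl// -EFinB; apply: le_trans; rewrite lee_fin.
  rewrite -mulrBr -mulrA ler_pM2l//.
  have : (rad / 2) ^+ d <= rad ^+ d / 2.
    rewrite exprMn ler_wpM2l// exprVn lef_pV2 ?posrE ?exprn_gt0//.
    by rewrite -[leLHS]expr1 ler_eXn2l// ltr1n.
  by move=> h; rewrite lerBrDr (le_trans (lerD (lexx _) h))// -splitr.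
have m0 : 0 <= Num.min r rad by rewrite le_min r0.
have min_ge0 z : (0 <= (Num.min r (enorm z))%:E :> \bar R)%E.
  by rewrite lee_fin min1_enorm_ge0.
apply: (@le_trans _ _ (4%:E * \int[mu]_(z in A') (Num.min r (enorm z))%:E)%E); last first.
  by rewrite lee_wpmul2l// subset_integral_nonneg// => x [].
apply: (@le_trans _ _ (4%:E * ((Num.min r rad / 2)%:E * mu A'))%E).
  rewrite muleA -EFinM; apply: (@le_trans _ _
    ((4 * (Num.min r rad / 2))%:E * (omega R d * rad ^+ d / 2)%:E)%E).
    by rewrite -EFinM lee_fin le_eqVlt; apply/orP; left; apply/eqP; field.
  by rewrite lee_wpmul2l// lee_fin mulr_ge0// divr_ge0.
rewrite lee_wpmul2l// -integral_cst//.
apply: le_integral_nonneg => x; first by rewrite lee_fin divr_ge0.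
move=> [_]; rewrite /eball /= => /negP; rewrite -leNgt => h; rewrite lee_fin.
rewrite le_min; apply/andP; split.
  by rewrite ler_pdivrMr// (@le_trans _ _ r)// ?ge_min ?lexx// ler_peMr// ler1n.
by apply: le_trans h; rewrite ler_pM2r ?invr_gt0// ge_min lexx orbT.
Qed.

End bathtub.

Section level_sum.
Context {R : realType} {d : nat}.
Local Notation T := (lebesgue_type R d).
Local Notation mu := (@lebesgue_rV R d).
Variables (K : 'rV[R]_d -> \bar R).
Hypotheses (d_gt0 : (0 < d)%N) (mK : measurable_fun (setT : set T) K).
Hypothesis K0 : forall x, (0 <= K x)%E.
Hypothesis K_moment :
  (\int[mu]_z (K z * (Num.min 1%R (enorm z))%:E) < +oo)%E.
Variables (b : R) (rad : nat -> R).
Hypotheses (b_gt0 : 0 < b) (rad_ge0 : forall n, 0 <= rad n).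
Hypothesis radE :
  forall n, mu (superlevel K (level b n)) = (omega R d * rad n ^+ d)%:E.

(** The weight min(r, R_n) is r times the weight min(1, R_n / r) of the ball estimate. In this form
    the sum is monotone in r, and at r = 1 it is finite by the moment hypothesis. *)
Definition level_sum (r : R) : \bar R :=
  (\sum_(n <oo) (level b n * (omega R d * rad n ^+ d * Num.min r (rad n)))%:E)%E.

Lemma level_term_ge0 r n : 0 <= r ->
  0 <= level b n * (omega R d * rad n ^+ d * Num.min r (rad n)).
Proof.
move=> r0; rewrite mulr_ge0 ?(ltW (level_gt0 _ _))//.
by rewrite mulr_ge0 ?mulr_ge0 ?exprn_ge0 ?(ltW omega_gt0)// le_min r0 rad_ge0.
Qed.

Lemma perimeter_rearrangement_le r : 0 < r ->
  (perimeter (rearrangement K) (eball r) <=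
    (Cd R d * omega R d * r ^+ d / r)%:E * level_sum r)%E.
Proof.
move=> r0.
have Kr0 x : (0 <= rearrangement K x)%E.
  by apply: integral_ge0 => t _; rewrite lee_fin.
apply: (le_trans (perimeter_ball_le d_gt0 Kr0 (l := level b) _ rad_ge0 _ r0)).
- by move=> n; exact/ltW/level_gt0.
- by move=> x; apply: rearrangement_le.
rewrite [X in (_ <= X%:E * _)%E](_ : _ =
  Cd R d * (omega R d * r ^+ d) * r^-1); last by rewrite !mulrA.
rewrite [X in (_ <= X * _)%E]EFinM -[leRHS]muleA; apply: lee_pmul => //.
- rewrite lee_fin mulr_ge0 ?(ltW Cd_gt0)// mulr_ge0 ?(ltW omega_gt0)//.
  by rewrite exprn_ge0// ltW.
- apply: nneseries_ge0 => n _ _; rewrite lee_fin mulr_ge0 ?(ltW (level_gt0 _ _))//.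
  rewrite mulr_ge0 ?mulr_ge0 ?exprn_ge0 ?(ltW omega_gt0)// le_min ler01.
  by rewrite divr_ge0// ltW.
rewrite /level_sum -nneseriesZl; last first.
  by move=> n _; rewrite lee_fin level_term_ge0// ltW.
rewrite le_eqVlt; apply/orP; left; apply/eqP; apply: eq_eseriesr => n _.
rewrite -EFinM; congr EFin.
have -> : Num.min r (rad n) = r * Num.min 1 (rad n / r).
  by rewrite minr_pMr ?(ltW r0)// mulr1 mulrCA divff ?gt_eqF// mulr1.
by field; rewrite gt_eqF.
Qed.

(** In 16 = 4 * 4 one factor comes from [bathtub] at each level, the other from [sum_level_le] at
    each point z. *)
Lemma level_sum_le r : 0 <= r ->
  (level_sum r <= 16%:E * \int[mu]_z (K z * (Num.min r (enorm z))%:E))%E.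
Proof.
move=> r0; rewrite /level_sum.
have mS n : measurable (superlevel K (level b n) : set T).
  exact: measurable_superlevel.
have l0 n : 0 <= level b n by exact/ltW/level_gt0.
pose w (z : T) : \bar R := (Num.min r (enorm (z : 'rV[R]_d)))%:E.
have w0 z : (0 <= w z)%E by rewrite lee_fin min1_enorm_ge0.
have mw : measurable_fun setT w by exact: measurable_min_enorm.
pose f n (z : T) : \bar R :=
  ((level b n)%:E * ((\1_(superlevel K (level b n)) z)%:E * w z))%E.
have f0 n z : (0 <= f n z)%E by rewrite !mule_ge0// lee_fin.
have mI n : measurable_fun setT (fun z : T => ((\1_(superlevel K (level b n)) z)%:E * w z)%E).
  apply: emeasurable_funM; last exact: mw.
  by apply/measurable_EFinP; exact: measurable_indic.
apply: (@le_trans _ _ (\sum_(n <oo) (4%:E * \int[mu]_z f n z))%E).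
  apply: le_series => n; first by rewrite lee_fin level_term_ge0.
  rewrite integralZl_lebesgue//; last by move=> z; rewrite mule_ge0// lee_fin.
  rewrite muleCA EFinM lee_wpmul2l ?lee_fin//.
  apply: (le_trans (bathtub d_gt0 (mS n) (rad_ge0 n) (radE n) r0)).
  rewrite lee_wpmul2l// [leLHS]integral_mkcond. apply: le_integral_nonneg => z _.
    by apply: erestrict_ge0 => y _; exact: (w0 y).
  rewrite patchE indicE; case: ifPn => // _; first by rewrite mul1e.
  by rewrite mul0e.
rewrite nneseriesZl; last by move=> n _; apply: integral_ge0.
have mf n : measurable_fun setT (f n) by apply: measurable_funeM; exact: mI.
rewrite -(integral_series mf f0).
have -> : 16%:E = (4%:E * 4%:E)%E :> \bar R by rewrite -EFinM; congr EFin; ring.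
rewrite -muleA lee_wpmul2l//.
have mKw : measurable_fun setT (fun z : T => K z * w z)%E.
  by apply: emeasurable_funM; [exact: mK|exact: mw].
have Kw0 z : (0 <= K z * w z)%E by rewrite mule_ge0.
rewrite -(integralZl_lebesgue mKw Kw0 (ler0n R 4)).
apply: le_integral_nonneg => z _; first exact: nneseries_ge0.
have -> : (\sum_(n <oo) f n z =
    w z * \sum_(n <oo) (level b n)%:E * (\1_(superlevel K (level b n)) z)%:E)%E.
  rewrite -nneseriesZl; last by move=> n _; rewrite mule_ge0// lee_fin.
  by apply: eq_eseriesr => n _; rewrite /f muleA muleC.
rewrite muleA muleC lee_wpmul2r//.
apply: le_trans (sum_level_le b_gt0 (K0 z)).
apply: le_series => n; first by rewrite mule_ge0// lee_fin.
rewrite indicE; case: (boolP (_ \in _)) => h.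
  by rewrite mule1 ifT//; move: h; rewrite inE => /ltW.
by rewrite mule0; case: ifP => //; rewrite lee_fin.
Qed.

End level_sum.


(** * Superlevel sets and support of the kernel *)

Section kernel_facts.
Context {R : realType} {d : nat}.
Local Notation T := (lebesgue_type R d).
Local Notation mu := (@lebesgue_rV R d).
Variables (K : 'rV[R]_d -> \bar R) (N : 'rV[R]_d -> R) (c0 : R).
Hypotheses (d_gt0 : (0 < d)%N) (K_kernel : is_kernel K) (NN : is_norm N).
Hypothesis K_moment :
  (\int[mu]_z (K z * (Num.min 1%R (enorm z))%:E) < +oo)%E.
Hypothesis c0_gt0 : 0 < c0.
Hypothesis K_dec : forall x y, N x <= N y -> (c0%:E * K y <= K x)%E.

Let mK : measurable_fun (setT : set T) K. Proof. by case: K_kernel. Qed.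
Let K0 x : (0 <= K x)%E. Proof. by case: K_kernel. Qed.
Let N_ge0 x : 0 <= N x. Proof. by case: NN. Qed.

Lemma measurable_set10 : measurable ([set 0] : set T).
Proof.
rewrite (_ : [set 0] = setT `&` (fun x : T => enorm (x : 'rV[R]_d)) @^-1` [set 0]).
  by apply: (@measurable_enorm R d) => //; exact: measurable_set1.
apply/seteqP; split => x /=; first by move=> ->; rewrite (is_norm0 enorm_is_norm).
by move=> [_]; have [_ + _ _] := @enorm_is_norm R d; apply.
Qed.

(** Dilation by 2 fixes the origin, so its finite measure x satisfies x = 2^-d x. *)
Lemma lebesgue_rV_set10 : mu [set 0] = 0%E.
Proof.
have fin : mu [set 0] \is a fin_num.
  rewrite ge0_fin_numE//; apply: (@le_lt_trans _ _ (mu (eball 1))).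
    by apply: le_lebesgue_rV => x ->; rewrite /eball /= (is_norm0 enorm_is_norm).
  by rewrite [ltLHS]eball_measure// ltry.
have := @lebesgue_rV_affine R d 2 0 [set 0] (ltr0n _ 2).
rewrite (_ : (fun x => _) = [set 0]); last first.
  apply/seteqP; split => x /=; rewrite addr0.
    by move=> /eqP; rewrite scaler_eq0 pnatr_eq0 /= => /eqP.
  by move=> ->; rewrite scaler0.
have [x xE] : exists x, mu [set 0] = x%:E by exists (fine (mu [set 0])); rewrite fineK.
rewrite xE -EFinM => -[hx].
have c1 : (2 : R)^-1 ^+ d < 1 by rewrite exprn_ilt1 ?invr_ge0 ?invf_lt1 ?ltr1n// -lt0n.
have /eqP : (1 - 2^-1 ^+ d) * x = 0 by rewrite mulrBl mul1r -hx subrr.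
by rewrite mulf_eq0 subr_eq0 gt_eqF//= => /eqP ->.
Qed.

Lemma kernel_pos : exists2 y, y != 0 & (0 < K y)%E.
Proof.
case: K_kernel => _ _; apply: contra_notP => H.
exists [set 0]; split; [exact: measurable_set10|exact: lebesgue_rV_set10|].
move=> y /= Ky; apply: contrapT => /eqP y0; apply: H; exists y => //.
by rewrite lt_neqAle K0 andbT eq_sym; exact/eqP.
Qed.

Lemma ex_real_lt (x : \bar R) : (0 < x)%E -> exists2 t : R, 0 < t & (t%:E < x)%E.
Proof.
case: x => [x|_|//]; last by exists 1 => //; rewrite ltry.
by rewrite lte_fin => x0; exists (x / 2); [rewrite divr_gt0|rewrite lte_fin; lra].
Qed.

Lemma norm_gt0 y : y != 0 -> 0 < N y.
Proof.
move=> y0; rewrite lt_def N_ge0 andbT; apply: contra y0 => /eqP Ny.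
by have [_ H _ _] := NN; rewrite (H _ Ny).
Qed.

(** Finiteness comes from the kernel: by almost monotonicity the N-ball of radius N y lies in a
    superlevel set as soon as K y > 0. Positivity comes from a small cube. *)
Lemma unit_norm_ball : exists2 v : R, 0 < v & mu [set x | N x < 1] = v%:E.
Proof.
have [y y0 Ky] := kernel_pos.
have Ny := norm_gt0 y0.
have fin : (mu [set x | (N x < 1)%R] < +oo)%E.
  have := norm_ball_measure NN Ny.
  have [t t0 tK] : exists2 t : R, 0 < t & (t%:E < c0%:E * K y)%E.
    by apply: ex_real_lt; rewrite mule_gt0.
  have sub : [set x | N x < N y] `<=` superlevel K t.
    by move=> x /= /ltW xy; rewrite /superlevel /= (lt_le_trans tK)// K_dec.
  have := le_lt_trans (le_lebesgue_rV sub)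
    (superlevel_finite d_gt0 mK K0 K_moment t0).
  move=> + E; rewrite E; rewrite !ltey; apply: contra => /eqP ->.
  by rewrite gt0_muley// lte_fin exprn_gt0.
pose S := \sum_(i < d) N (delta_mx ord0 i).
have S0 : 0 <= S by rewrite sumr_ge0.
pose e := (S + 1)^-1.
have e0 : 0 < e by rewrite invr_gt0 ltr_pwDr.
have sub : cube 0 e `<=` [set x | N x < 1].
  move=> x xe /=; apply: (le_lt_trans (is_norm_le_coord NN (ltW e0) _)).
    by move=> i; have := xe i; rewrite mxE subr0 => /ltW.
  by rewrite mulrC ltr_pdivrMr ?ltr_pwDr// mul1r ltrDl.
exists (fine (mu [set x | N x < 1])); last by rewrite fineK// ge0_fin_numE.
rewrite -lte_fin fineK ?ge0_fin_numE//.
apply: lt_le_trans (le_lebesgue_rV sub); rewrite lebesgue_rV_cube// lte_fin.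
by rewrite exprn_gt0// mulr_gt0.
Qed.

Lemma norm_ballE s v : mu [set x | N x < 1] = v%:E -> 0 < s ->
  mu [set x | N x < s] = (s ^+ d * v)%:E.
Proof. by move=> vE s0; rewrite norm_ball_measure// vE. Qed.

Lemma kernel_moment_integrable :
  mu.-integrable setT (fun z : T => K z * (Num.min 1%R (enorm z))%:E)%E.
Proof.
apply/integrableP; split.
  by apply: emeasurable_funM; [exact: mK|exact: measurable_min_enorm].
under eq_integral => z _.
  rewrite gee0_abs; last by rewrite mule_ge0// lee_fin min1_enorm_ge0.
  over.
exact: K_moment.
Qed.

(** The moment integrand is finite almost everywhere and its weight vanishes only at the origin,
    where nothing can be said of K. *)
Lemma kernel_finite_ae : exists A : set T, [/\ measurable A, mu A = 0%E &
  forall x, ~ A x -> x != 0 -> (K x < +oo)%E].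
Proof.
have [A [mA A0 sub]] := integrable_ae measurableT kernel_moment_integrable.
exists A; split => // x nA x0; apply: contrapT => /negP; rewrite -leNgt leye_eq.
move=> /eqP Kx; apply: nA; apply: sub => /= /(_ Logic.I).
rewrite Kx gt0_mulye// lte_fin lt_min ltr01 lt_def.
have [e0 ee0 _ _] := @enorm_is_norm R d; rewrite e0 andbT.
by apply: contra x0 => /eqP /ee0 ->.
Qed.

(** Some x with N x < 1 has K x finite. If N y > 1, almost monotonicity gives K y <= K x / c0, which
    lies below the chosen b. *)
Lemma ex_threshold : exists2 b : R, 0 < b & forall y, (b%:E < K y)%E -> N y <= 1.
Proof.
have [A [mA A0 finA]] := kernel_finite_ae.
have [v v0 vE] := unit_norm_ball.
have [x [Nx x0 nA]] : exists x, [/\ N x < 1, x != 0 & ~ A x].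
  apply: contrapT => H.
  have : (mu [set x | (N x < 1)%R] <= mu (A `|` [set 0%R]))%E.
    apply: le_lebesgue_rV => x /= Nx; apply: contrapT => nAx; apply: H.
    exists x; split => //; last by move=> Ax; apply: nAx; left.
    by apply/eqP => x0; apply: nAx; right.
  move=> /le_trans /(_ (lebesgue_rVU2 _ _)).
  by rewrite vE A0 lebesgue_rV_set10 adde0 lee_fin leNgt v0.
have Kx := finA _ nA x0.
have Kfin : K x \is a fin_num by rewrite ge0_fin_numE.
exists (fine (K x) / c0 + 1).
  by rewrite ltr_pwDr// divr_ge0 ?fine_ge0// ltW.
move=> y; apply: contraTT; rewrite -ltNge -leNgt => Ny.
have := K_dec (ltW (lt_trans Nx Ny)).
rewrite -(fineK Kfin) -lee_pdivlMl// => /le_trans; apply.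
by rewrite -EFinM lee_fin mulrC lerDl.
Qed.

(** The N-ball of radius theta rad has smaller measure than the superlevel set, so the latter has a
    point y with N y >= theta rad. Almost monotonicity at y gives the first claim, and any bound s
    on N over the set gives the second. *)
Lemma level_inclusion v (t rad theta : R) : mu [set x | N x < 1] = v%:E ->
  0 < theta -> theta ^+ d * v < omega R d -> 0 <= t -> 0 <= rad ->
  mu (superlevel K t) = (omega R d * rad ^+ d)%:E ->
  (forall z, N z < theta * rad -> ((c0 * t)%:E <= K z)%E) /\
  (forall s, (forall y, (t%:E < K y)%E -> N y <= s) -> 0 <= s -> theta * rad <= s).
Proof.
move=> vE th0 thv t0; rewrite le_eqVlt => /predU1P[<- _|rad0 E].
  by split => [z|s _ s0]; rewrite mulr0// ltNge N_ge0.
have [y [tK yN]] : exists y, (t%:E < K y)%E /\ theta * rad <= N y.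
  apply: contrapT => H.
  have : (mu (superlevel K t) <= mu [set x | (N x < theta * rad)%R])%E.
    apply: le_lebesgue_rV => y yt /=; rewrite ltNge; apply/negP => yN.
    by apply: H; exists y.
  rewrite E (norm_ballE vE) ?mulr_gt0// lee_fin leNgt exprMn mulrAC.
  by rewrite ltr_pM2r ?exprn_gt0// thv.
split => [z zN|s H _]; last exact: le_trans (H _ tK).
apply: le_trans (K_dec (ltW (lt_le_trans zN yN))).
by rewrite EFinM lee_wpmul2l// ?lee_fin ltW.
Qed.

(** Dominated convergence along r = 1 / (n + 1), with the moment integrand as dominating function.
    At the origin, where K may be infinite, the weight is 0. *)
Lemma moment_small (e : R) : 0 < e -> exists r, 0 < r <= 1 /\
  (\int[mu]_z (K z * (Num.min r (enorm z))%:E) <= e%:E)%E.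
Proof.
move=> e0.
pose f (n : nat) (z : T) : \bar R :=
  (K z * (Num.min n.+1%:R^-1 (enorm (z : 'rV[R]_d)))%:E)%E.
have f0 n z : (0 <= f n z)%E by rewrite mule_ge0// lee_fin min1_enorm_ge0.
have mf n : measurable_fun setT (f n).
  by apply: emeasurable_funM; [exact: mK|exact: measurable_min_enorm].
have [A [mA A0 finA]] := kernel_finite_ae.
have cv : {ae mu, forall z, [set: T] z -> f n z @[n --> \oo] --> (0 : \bar R)}.
  exists A; split => // z /= H; apply: contrapT => nA; apply: H => _.
  have [->|z0] := eqVneq (z : 'rV[R]_d) 0.
    rewrite (_ : (fun n => _) = fun=> 0%E); first exact: cvg_cst.
    apply/funext => n; rewrite /f (is_norm0 enorm_is_norm) min_r ?invr_ge0//.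
    by rewrite mule0.
  have Kfin : K z \is a fin_num by rewrite ge0_fin_numE// finA.
  have h0 : ((fine (K z) * n.+1%:R^-1)%:E @[n --> \oo] --> (0 : \bar R)).
    apply/fine_cvgP; split; first by apply: nearW => n.
    rewrite -(mulr0 (fine (K z))); apply: cvgM; first exact: cvg_cst.
    exact: cvg_harmonic.
  apply: (squeeze_cvge _ (cvg_cst 0%E) h0); apply: nearW => n.
  by rewrite f0/= EFinM fineK// lee_wpmul2l// lee_fin ge_min lexx.
have dom : {ae mu, forall z n, [set: T] z ->
    (`|f n z| <= K z * (Num.min 1%R (enorm z))%:E)%E}.
  apply: aeW => z n _; rewrite gee0_abs// lee_wpmul2l// lee_fin.
  by rewrite le_min ge_min invf_le1// ler1n /= ge_min lexx orbT.
have [_ _] := dominated_convergence measurableT mf (measurable_cst 0%E) cv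
  kernel_moment_integrable dom.
rewrite integral0 => /fine_cvgP[nf cf].
move/cvgr_lt : cf => /(_ _ e0) ne.
have [n [h1 h2]] := filter_ex (filterI nf ne).
exists n.+1%:R^-1; split; first by rewrite invr_gt0 ltr0n/= invf_le1// ler1n.
by rewrite -[X in (X <= _)%E](fineK h1) lee_fin ltW.
Qed.

End kernel_facts.


(** * Consequences of the isoperimetric hypothesis *)

Section isoperimetric_kernel.
Context {R : realType} {d : nat}.
Local Notation T := (lebesgue_type R d).
Local Notation mu := (@lebesgue_rV R d).
Variables (K : 'rV[R]_d -> \bar R) (N : 'rV[R]_d -> R) (c0 : R) (p C1 : R).
Hypotheses (d_gt0 : (0 < d)%N) (K_kernel : is_kernel K) (NN : is_norm N).
Hypothesis K_moment :
  (\int[mu]_z (K z * (Num.min 1%R (enorm z))%:E) < +oo)%E.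
Hypothesis c0_gt0 : 0 < c0.
Hypothesis K_dec : forall x y, N x <= N y -> (c0%:E * K y <= K x)%E.
Hypothesis C1_gt0 : 0 < C1.
Hypothesis K_iso : forall m : R, 0 < m ->
  ((m `^ p / C1)%:E <= perimeter (rearrangement K) (ball_of_measure m))%E.

Let mK : measurable_fun (setT : set T) K. Proof. by case: K_kernel. Qed.
Let K0 x : (0 <= K x)%E. Proof. by case: K_kernel. Qed.
Let w0 : 0 < omega R d := @omega_gt0 R d.

Lemma ex_level_radii (b : R) : 0 < b -> exists rad : nat -> R,
  (forall n, 0 <= rad n) /\
  (forall n, mu (superlevel K (level b n)) = (omega R d * rad n ^+ d)%:E).
Proof.
move=> b0.
have /choice[rad H] : forall n, exists r, 0 <= r /\
    mu (superlevel K (level b n)) = (omega R d * r ^+ d)%:E.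
  move=> n.
  have [r [r0 rE _]] := superlevel_radius d_gt0 mK K0 K_moment (level_gt0 n b0).
  by exists r.
by exists rad; split => n; have [] := H n.
Qed.

Section with_levels.
Variables (b : R) (rad : nat -> R).
Hypotheses (b_gt0 : 0 < b) (rad_ge0 : forall n, 0 <= rad n).
Hypothesis radE :
  forall n, mu (superlevel K (level b n)) = (omega R d * rad n ^+ d)%:E.

Lemma iso_level_sum r : 0 < r ->
  (((omega R d * r ^+ d) `^ p / C1)%:E <=
    (Cd R d * omega R d * r ^+ d / r)%:E * level_sum (d := d) b rad r)%E.
Proof.
move=> r0.
have m0 : 0 < omega R d * r ^+ d by rewrite mulr_gt0// exprn_gt0.
have [s [s0 sm sE]] := ball_of_measureE d_gt0 (ltW m0).
have rs := radius_inj d_gt0 s0 (ltW r0) sm.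
have := K_iso m0; rewrite sE rs => /le_trans; apply.
exact: perimeter_rearrangement_le.
Qed.

Lemma level_sum_ge0 r : 0 <= r -> (0 <= level_sum (d := d) b rad r)%E.
Proof. by move=> r0; apply: nneseries_ge0 => n _ _; rewrite lee_fin level_term_ge0. Qed.

Lemma level_sum1_finite : (level_sum (d := d) b rad 1 < +oo)%E.
Proof.
apply: le_lt_trans (level_sum_le d_gt0 mK K0 b_gt0 rad_ge0 radE ler01) _.
by apply: lte_mul_pinfty => //; apply: integral_ge0 => z _;
  rewrite mule_ge0// lee_fin min1_enorm_ge0.
Qed.

(** The power of r left on the left of [iso_level_sum] after division by r^(d - 1). *)
Definition iso_exponent : R := d%:R * p - d%:R + 1.

Lemma iso_pow : exists2 C : R, 0 < C & forall r Y, 0 < r ->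
  (level_sum (d := d) b rad r <= Y%:E)%E -> r `^ iso_exponent <= C * Y.
Proof.
have wp : 0 < omega R d `^ p by exact: powR_gt0.
have cd := @Cd_gt0 R d.
exists (C1 * Cd R d * omega R d / omega R d `^ p).
  by rewrite divr_gt0// !mulr_gt0.
move=> r Y r0 hY.
have rd : 0 < r ^+ d by rewrite exprn_gt0.
have := iso_level_sum r0.
move=> /le_trans /(_ (lee_wpmul2l _ hY)).
have -> : (0 <= (Cd R d * omega R d * r ^+ d / r)%:E)%E.
  by rewrite lee_fin divr_ge0 ?(ltW r0)// !mulr_ge0// ltW.
move=> /(_ isT); rewrite -EFinM lee_fin powRM ?(ltW w0) ?(ltW rd)//.
rewrite -powR_mulrn ?(ltW r0)// -powRrM => h.
have rE : r `^ iso_exponent = r `^ (d%:R * p) * (r `^ d%:R)^-1 * r.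
  have r1 : r = r `^ 1 by rewrite powRr1// ltW.
  rewrite [X in _ = _ * X]r1 -powRN -!powRD ?(gt_eqF r0) ?implybT//.
rewrite rE.
have rd' : 0 < r `^ d%:R by exact: powR_gt0.
rewrite -(@ler_pM2l _ (omega R d `^ p / C1 * (r `^ d%:R / r))); last first.
  by rewrite mulr_gt0// divr_gt0.
move: h; congr (_ <= _); field; rewrite !gt_eqF//.
Qed.

End with_levels.

(* With bounded support, [level_sum] stays bounded as r grows, so the exponent is
   at most 0; but [level_sum] tends to 0 with r, so the exponent is positive. *)
Lemma kernel_support_unbounded rho : exists y, rho <= N y /\ (0 < K y)%E.
Proof.
apply: contrapT => H.
pose s := Num.max rho 1.
have s0 : 0 < s by rewrite lt_max ltr01 orbT.
have Ks y : (0 < K y)%E -> N y < s.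
  move=> Ky; rewrite ltNge; apply/negP => sy; apply: H; exists y; split => //.
  by apply: le_trans sy; rewrite le_max lexx.
have [rad [rad0 radE]] := ex_level_radii ltr01.
have [C C0 iso] := iso_pow ltr01 rad0 radE.
have [v v0 vE] := unit_norm_ball d_gt0 K_kernel NN K_moment c0_gt0 K_dec.
have [M [M1 radM]] : exists M, 1 <= M /\ forall n, rad n <= M.
  have sv : 0 <= s ^+ d * v by rewrite mulr_ge0 ?exprn_ge0 ?ltW.
  have [M M0 ME] := ex_radius d_gt0 sv.
  exists (Num.max M 1); split; first by rewrite le_max lexx orbT.
  move=> n; rewrite le_max; apply/orP; left.
  have : (mu (superlevel K (level 1 n)) <= mu [set x | (N x < s)%R])%E.
    apply: le_lebesgue_rV => y; rewrite /superlevel /= => yl; apply: Ks.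
    by apply: lt_trans yl; rewrite lte_fin level_gt0.
  rewrite radE (norm_ballE NN vE s0) -ME lee_fin ler_pM2l//.
  by rewrite ler_pXn2r ?nnegrE.
have M0 : 0 < M by exact: lt_le_trans M1.
have fin1 := level_sum1_finite ltr01 rad0 radE.
pose L := fine (level_sum (d := d) 1 rad 1).
have LE : level_sum (d := d) 1 rad 1 = L%:E.
  by rewrite fineK// ge0_fin_numE// level_sum_ge0.
(* From 1 <= M and rad n <= M follows min(r, rad n) <= rad n <= M min(1, rad n). *)
have bound r : 0 < r -> (level_sum (d := d) 1 rad r <= (M * L)%:E)%E.
  move=> r0; rewrite EFinM -LE /level_sum -nneseriesZl; last first.
    by move=> n _; rewrite lee_fin level_term_ge0.
  apply: le_series => n; first by rewrite lee_fin level_term_ge0// ltW.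
  have l0 := level_gt0 n (ltr01 : 0 < 1 :> R).
  rewrite -EFinM lee_fin.
  rewrite [leRHS](_ : _ =
    level 1 n * (omega R d * rad n ^+ d * (M * Num.min 1 (rad n)))); last by ring.
  rewrite ler_pM2l// ler_wpM2l//.
    by rewrite mulr_ge0 ?exprn_ge0// ltW.
  apply: (@le_trans _ _ (rad n)); first by rewrite ge_min lexx orbT.
  have [r1|r1] := leP 1 (rad n); first by rewrite mulr1.
  by rewrite ler_peMl.
have B r : 0 < r -> r `^ iso_exponent <= C * (M * L).
  by move=> r0; apply: iso => //; exact: bound.
have beta : iso_exponent <= 0.
  rewrite leNgt; apply/negP => b0.
  have B1 : 0 <= C * (M * L) by apply: le_trans (B 1 ltr01); exact: powR_ge0.
  (* At this r the power equals the supposed bound plus 1. *)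
  have := B ((C * (M * L) + 1) `^ iso_exponent^-1).
  rewrite powR_gt0 ?ltr_pwDr// => /(_ isT).
  rewrite -powRrM mulVf ?gt_eqF// powRr1 ?addr_ge0//.
  by rewrite leNgt ltrDl ltr01.
(* Together with the factor 16 of [level_sum_le] and the constant [C] this leaves 1 / 2, whereas the
   power is at least 1 for r <= 1. *)
have e0 : 0 < (32 * C)^-1 by rewrite invr_gt0 mulr_gt0.
have [r [/andP[r0 r1] small]] := moment_small K_kernel K_moment e0.
have : (level_sum (d := d) 1 rad r <= (16 * (32 * C)^-1)%:E)%E.
  apply: (le_trans (level_sum_le d_gt0 mK K0 ltr01 rad0 radE (ltW r0))).
  by rewrite EFinM lee_wpmul2l.
move=> /(iso _ _ r0).
have : 1 <= r `^ iso_exponent.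
  rewrite -[X in _ `^ X]opprK powRN -[leLHS]invr1 lef_pV2 ?posrE ?powR_gt0//.
  have <- : 1 `^ (- iso_exponent) = 1 :> R by rewrite powR1.
  apply: ge0_ler_powR; rewrite ?nnegrE ?oppr_ge0//.
  exact: ltW.
move=> h1 /(le_trans h1); have -> : C * (16 * (32 * C)^-1) = 2^-1.
  by field; rewrite gt_eqF.
lra.
Qed.

(** Some y with K y > 0 is at least as long in N as every difference of two points of [Omega];
    almost monotonicity applies at y. *)
Lemma kernel_lower_bounded Omega : bounded_set Omega ->
  exists2 k : R, 0 < k & forall x y, Omega x -> Omega y -> (k%:E <= K (x - y))%E.
Proof.
move=> /bounded_setP[M M0 OM].
have [y [Ny Ky]] := kernel_support_unbounded ((M + M) * \sum_(i < d) N (delta_mx ord0 i)).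
have [k k0 kK] : exists2 k : R, 0 < k & (k%:E < c0%:E * K y)%E.
  by apply: ex_real_lt; rewrite mule_gt0.
exists k => // x x' Ox Ox'; apply: (le_trans (ltW kK)); apply: K_dec.
apply: le_trans Ny; apply: (is_norm_le_coord NN); first by rewrite addr_ge0 ?ltW.
move=> i; rewrite !mxE (le_trans (ler_normB _ _))//.
by rewrite lerD ?OM.
Qed.

End isoperimetric_kernel.


(** * The relative inequality *)

Section interaction_lower.
Context {R : realType} {d : nat}.
Local Notation T := (lebesgue_type R d).
Local Notation mu := (@lebesgue_rV R d).
Implicit Types (K : 'rV[R]_d -> \bar R) (N : 'rV[R]_d -> R).
Implicit Types (Omega E F G : set 'rV[R]_d).

Lemma le_integral_off_null (f1 f2 : T -> \bar R) (Z : set T) :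
  measurable_fun setT f1 -> measurable_fun setT f2 ->
  (forall x, 0 <= f1 x)%E -> (forall x, 0 <= f2 x)%E ->
  measurable Z -> mu Z = 0%E -> (forall x, ~ Z x -> f1 x <= f2 x)%E ->
  (\int[mu]_x f1 x <= \int[mu]_x f2 x)%E.
Proof.
move=> mf1 mf2 f10 f20 mZ Z0 f12.
apply: (@ae_ge0_le_integral _ T R mu setT measurableT f1 f2).
- by move=> x _.
- exact: mf1.
- by move=> x _.
- exact: mf2.
exists Z; split => // x /= H; apply: contrapT => nZ; apply: H => _.
exact: f12.
Qed.

(** On [Omega] the sets [E] and [G] separate the same pairs, and [F] is a Borel hull of [G] cut by
    [Omega]. The series is built on [F], where measurability on pairs holds; K (x - y) is only
    bounded from below pointwise. *)
Lemma interaction_ge_series K N Omega E G (l s : nat -> R) :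
  (forall x, 0 <= K x)%E -> is_norm N -> borel_rV Omega ->
  measurable (G : set T) -> G `<=` Omega -> (mu G < +oo)%E ->
  (forall x y, Omega x -> Omega y ->
     ((x \in E) != (y \in E)) = ((x \in G) != (y \in G))) ->
  (forall n, 0 <= l n) ->
  (forall z, (\sum_(n <oo) (l n)%:E * (\1_[set x | (N x < s n)%R] z)%:E <= K z)%E) ->
  exists F, [/\ borel_rV F, F `<=` Omega, mu F = mu G &
    (\sum_(n <oo) (l n)%:E * \int[mu]_x mu (xsection (separated Omega N F (s n)) x)
       <= interaction K E Omega Omega)%E].
Proof.
move=> K0 NN bO mG GO Goo EG l0 lK.
have [B [bB GB BG0]] := borel_hull mG Goo.
pose F := B `&` Omega.
have bF : borel_rV F by exact: measurableI.
have mF := borel_measurable bF.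
have GF : G `<=` F by move=> x Gx; split; [exact: GB|exact: GO].
pose Z : set T := F `\` G.
have mZ : measurable Z by exact: measurableD.
have Z0 : mu Z = 0%E.
  apply/eqP; rewrite eq_le measure_ge0 andbT -BG0; apply: le_lebesgue_rV.
  by move=> x [[Bx _] nG].
exists F; split => //.
- by move=> x [].
- apply/eqP; rewrite eq_le (le_lebesgue_rV GF) andbT.
  apply: (@le_trans _ _ (mu (G `|` Z))).
    by apply: le_lebesgue_rV => x Fx; have [Gx|Gx] := pselect (G x); [left|right].
  by apply: (le_trans (lebesgue_rVU2 _ _)); rewrite Z0 adde0.
(* Away from the null set [Z], being separated by [F] and by [G] is the same. Removing it changes
   the section at x only within [Z], for x outside [Z]. *)
pose A n : set (T * T) := separated Omega N F (s n) `&`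
  (fst @^-1` (~` Z) `&` snd @^-1` (~` Z)).
have mA0 n : measurable (separated Omega N F (s n)) by exact: measurable_separated.
have mA n : measurable (A n).
  apply: measurableI => //; apply: measurableI; rewrite -[X in measurable X]setTI.
    by apply: measurable_fst => //; exact: measurableC.
  by apply: measurable_snd => //; exact: measurableC.
apply: (@le_trans _ _ (\sum_(n <oo) (l n)%:E * \int[mu]_x mu (xsection (A n) x))%E).
  apply: le_series => n.
    by rewrite mule_ge0 ?lee_fin// integral_ge0.
  rewrite lee_wpmul2l ?lee_fin//.
  apply: (le_integral_off_null (f1 := fun x => mu (xsection (separated Omega N F (s n)) x))
    (f2 := fun x => mu (xsection (A n) x)) _ _ _ _ mZ Z0).
  - exact: (measurable_fun_xsection mu (mA0 n)).
  - exact: (measurable_fun_xsection mu (mA n)).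
  - by move=> x; exact: measure_ge0.
  - by move=> x; exact: measure_ge0.
  move=> x nZ.
  apply: (@le_trans _ _ (mu (xsection (A n) x `|` Z))).
    apply: le_lebesgue_rV => y Hy; have [Zy|Zy] := pselect (Z y); [by right|left].
    by apply: mem_set; split; [exact: set_mem Hy|].
  by apply: (le_trans (lebesgue_rVU2 _ _)); rewrite Z0 adde0.
rewrite -integral2_series// /interaction.
rewrite [leRHS]integral_mkcond; apply: le_integral_nonneg => x _.
  by apply: integral_ge0 => y _; apply: nneseries_ge0 => n _ _;
    rewrite mule_ge0// lee_fin.
rewrite patchE; case: ifPn => xO; last first.
  rewrite integral0_eq// => y _; rewrite eseries0// => n _ _.
  rewrite indicE memNset ?mule0// => -[[Ox _ _ _] _].
  by move/negP : xO; apply; rewrite inE.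
rewrite [leRHS]integral_mkcond; apply: le_integral_nonneg => y _.
  by apply: nneseries_ge0 => n _ _; rewrite mule_ge0// lee_fin.
rewrite patchE; case: ifPn => yO; last first.
  rewrite eseries0// => n _ _.
  rewrite indicE memNset ?mule0// => -[[_ Oy _ _] _].
  by move/negP : yO; apply; rewrite inE.
move: xO yO; rewrite !inE => Ox Oy.
have [neq|eq] := boolP ((x \in E) != (y \in E)); last first.
  rewrite eseries0.
    by rewrite mule_ge0// lee_fin.
  move=> n _ _; rewrite indicE memNset ?mule0// => -[[_ _ _ h] [/= Zx Zy]].
  move: eq; rewrite EG// => /negP; apply.
  move: h.
  have FG u : ~ Z u -> (u \in F) = (u \in G).
    move=> Zu; apply/idP/idP; rewrite !inE; last exact: GF.
    by move=> Fu; apply: contrapT => Gu; apply: Zu.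
  by rewrite (FG _ Zx) (FG _ Zy).
have -> : `|\1_E x - \1_E y| = 1 :> R.
  rewrite !indicE; move: neq; case: (_ \in _); case: (_ \in _) => //= _;
      by rewrite ?subr0 ?sub0r ?normrN ?normr1.
rewrite mul1e; apply: le_trans (lK _); apply: le_series => n.
  by rewrite mule_ge0// lee_fin.
rewrite lee_wpmul2l ?lee_fin// !indicE.
case: (boolP (_ \in A n)) => //; rewrite inE => -[[_ _ xy _] _].
by rewrite mem_set.
Qed.

Lemma interaction_ge_product K Omega E (k : R) :
  (forall x, 0 <= K x)%E -> measurable (Omega : set T) -> measurable (E : set T) ->
  0 <= k -> (forall x y, Omega x -> Omega y -> (k%:E <= K (x - y)%R)%E) ->
  (k%:E * (mu (E `&` Omega) * mu (Omega `\` E)) <= interaction K E Omega Omega)%E.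
Proof.
move=> K0 mO mE k0 kK.
have mA : measurable (E `&` Omega : set T) by exact: measurableI.
have mB : measurable (Omega `\` E : set T) by exact: measurableD.
rewrite /interaction.
apply: (@le_trans _ _ (\int[mu]_(x in E `&` Omega)
    (k%:E * mu (Omega `\` E)))%E).
  by rewrite integral_cst// -muleA [X in (_ * X <= _)%E]muleC.
apply: (@le_trans _ _ (\int[mu]_(x in E `&` Omega)
    \int[mu]_(y in Omega) (`|\1_E x - \1_E y|%:E * K (x - y)%R))%E); last first.
  apply: subset_integral_nonneg => x; first by case.
  by move=> _; apply: integral_ge0 => y _; rewrite mule_ge0// lee_fin.
apply: le_integral_nonneg => x; first by rewrite mule_ge0// lee_fin.
move=> [Ex Ox]; rewrite -integral_cst//.
apply: (@le_trans _ _ (\int[mu]_(y in Omega `\` E)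
    (`|\1_E x - \1_E y|%:E * K (x - y)%R))%E); last first.
  apply: subset_integral_nonneg => y; first by case.
  by move=> _; rewrite mule_ge0// lee_fin.
apply: le_integral_nonneg => y [Oy nEy]; first by rewrite lee_fin.
rewrite !indicE (mem_set Ex) (memNset nEy) subr0 normr1 mul1e; exact: kK.
Qed.

Lemma separated_lower_omega Omega N : (1 <= d)%N -> open Omega ->
  bounded_set Omega -> lipschitz_boundary Omega -> is_norm N ->
  exists c r0 : R, [/\ 0 < c, 0 < r0 &
    forall F r s, borel_rV F -> F `<=` Omega -> 0 < r <= r0 ->
      mu F = (omega R d * r ^+ d)%:E -> 0 <= s <= 1 ->
      ((c * (r ^+ d * (s ^+ d * Num.min 1 (s / r))))%:E <=
       \int[mu]_x mu (xsection (separated Omega N F s) x))%E].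
Proof.
move=> d1 oO bO lO NN.
have [c [r0 [c0 r00 H]]] := separated_lower d1 oO bO lO NN.
have w0 : 0 < omega R d := @omega_gt0 R d.
pose g := omega R d `^ d%:R^-1.
have g0 : 0 < g by exact: powR_gt0.
have gE : g ^+ d = omega R d.
  rewrite -powR_mulrn ?(ltW g0)// -powRrM mulVf ?pnatr_eq0 -?lt0n//.
  by rewrite powRr1// ltW.
have h0 : 0 < Num.min 1 g^-1 by rewrite lt_min ltr01 invr_gt0.
exists (c * omega R d * Num.min 1 g^-1), (r0 / g); split.
- by rewrite !mulr_gt0.
- by rewrite divr_gt0.
move=> F r s bF FO /andP[r_gt0 rr0] mF /andP[s_ge0 s1].
have I0 t : (0 <= \int[mu]_x mu (xsection (separated Omega N F t) x))%E.
  exact: integral_ge0.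
move: s_ge0; rewrite le_eqVlt => /predU1P[<-|s0].
  rewrite expr0n gtn_eqF// mul0r !mulr0; exact: I0.
have gr0 : 0 < g * r <= r0 by rewrite mulr_gt0//= mulrC -ler_pdivlMr.
have s01 : 0 < s <= 1 by rewrite s0.
have mF' : mu F = ((g * r) ^+ d)%:E by rewrite exprMn gE.
apply: le_trans (H F (g * r) s bF FO gr0 mF' s01).
rewrite lee_fin exprMn gE.
rewrite [leLHS](_ : _ = c * (omega R d * r ^+ d *
  (s ^+ d * (Num.min 1 g^-1 * Num.min 1 (s / r))))); last by ring.
rewrite ler_pM2l// ler_pM2l ?mulr_gt0 ?exprn_gt0// ler_pM2l ?exprn_gt0//.
have sr0 : 0 < s / r by rewrite divr_gt0.
have m0 : 0 <= Num.min 1 (s / r) by rewrite le_min ler01 ltW.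
rewrite le_min; apply/andP; split.
  rewrite -[leRHS]mulr1; apply: ler_pM => //; first exact: ltW.
    by rewrite ge_min lexx.
  by rewrite ge_min lexx.
have -> : s / (g * r) = g^-1 * (s / r) by field; rewrite !gt_eqF.
apply: ler_pM => //; first exact: ltW.
  by rewrite ge_min lexx orbT.
by rewrite ge_min lexx orbT.
Qed.

End interaction_lower.


(** * Comparison of the two sides level by level *)

Section relative_inequality.
Context {R : realType} {d : nat}.
Local Notation T := (lebesgue_type R d).
Local Notation mu := (@lebesgue_rV R d).
Variables (K : 'rV[R]_d -> \bar R) (N : 'rV[R]_d -> R) (c0 : R) (p C1 : R).
Variable (Omega : set 'rV[R]_d).
Hypotheses (d_gt0 : (0 < d)%N) (K_kernel : is_kernel K) (NN : is_norm N).
Hypothesis K_moment :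
  (\int[mu]_z (K z * (Num.min 1%R (enorm z))%:E) < +oo)%E.
Hypothesis c0_gt0 : 0 < c0.
Hypothesis K_dec : forall x y, N x <= N y -> (c0%:E * K y <= K x)%E.
Hypothesis C1_gt0 : 0 < C1.
Hypothesis K_iso : forall m : R, 0 < m ->
  ((m `^ p / C1)%:E <= perimeter (rearrangement K) (ball_of_measure m))%E.
Hypotheses (oO : open Omega) (bO : bounded_set Omega).
Hypothesis lO : lipschitz_boundary Omega.

Let mK : measurable_fun (setT : set T) K. Proof. by case: K_kernel. Qed.
Let K0 x : (0 <= K x)%E. Proof. by case: K_kernel. Qed.
Let w0 : 0 < omega R d := @omega_gt0 R d.

(** Only the levels at least b, where the superlevel sets lie in the closed unit N-ball when b is
    the threshold of [ex_threshold]. *)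
Definition high_sum (b : R) (rad : nat -> R) (r : R) : \bar R :=
  (\sum_(n <oo) (if b <= level b n then
     level b n * (omega R d * rad n ^+ d * Num.min 1 (rad n / r)) else 0)%:E)%E.

Section with_levels.
Variables (b : R) (rad : nat -> R).
Hypotheses (b_gt0 : 0 < b) (rad_ge0 : forall n, 0 <= rad n).
Hypothesis radE :
  forall n, mu (superlevel K (level b n)) = (omega R d * rad n ^+ d)%:E.

Let l0 n : 0 < level b n := level_gt0 n b_gt0.

Let term_ge0 r n : 0 < r ->
  0 <= level b n * (omega R d * rad n ^+ d * Num.min 1 (rad n / r)).
Proof.
move=> r0; rewrite mulr_ge0 ?(ltW (l0 n))// mulr_ge0//.
  by rewrite mulr_ge0 ?(ltW w0)// exprn_ge0.
by rewrite le_min ler01 divr_ge0// ltW.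
Qed.

Lemma high_sum_ge0 r : 0 < r -> (0 <= high_sum b rad r)%E.
Proof.
move=> r0; apply: nneseries_ge0 => n _ _; rewrite lee_fin.
by case: ifP => // _; exact: term_ge0.
Qed.

(** The low levels are absorbed in [S]. Where rad n < 1 the term is at most omega times the level,
    and these levels sum to at most 4 b; where rad n >= 1 it is at most the term of [level_sum] at r
    = 1. *)
Lemma iso_high_sum : exists2 S : R, 0 <= S & forall r, 0 < r ->
  (((omega R d * r ^+ d) `^ p / C1)%:E <=
    (Cd R d * omega R d * r ^+ d)%:E * (high_sum b rad r + S%:E))%E.
Proof.
pose L := fine (level_sum (d := d) b rad 1).
have LE : level_sum (d := d) b rad 1 = L%:E.
  rewrite fineK// ge0_fin_numE ?level_sum_ge0//.
  exact: (level_sum1_finite d_gt0 K_kernel K_moment b_gt0 rad_ge0 radE).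
have L0 : 0 <= L by rewrite fine_ge0// level_sum_ge0.
exists (L + omega R d * (4 * b)).
  by rewrite addr_ge0// mulr_ge0 ?(ltW w0)// mulr_ge0// ltW.
move=> r r0.
apply: (le_trans (iso_level_sum d_gt0 K_kernel K_moment K_iso b_gt0 rad_ge0 radE r0)).
rewrite [X in (X * _ <= _)%E]EFinM -muleA; apply: lee_pmul.
- by rewrite lee_fin mulr_ge0 ?exprn_ge0 ?(ltW r0)// mulr_ge0 ?(ltW w0)// ltW// Cd_gt0.
- by rewrite mule_ge0 ?level_sum_ge0 ?lee_fin ?invr_ge0 ?(ltW r0).
- by [].
pose low n : R := if level b n <= b then omega R d * level b n else 0.
have low0 n : 0 <= low n.
  by rewrite /low; case: ifP => // _; rewrite mulr_ge0 ?(ltW w0)// ltW.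
have lowS : (\sum_(n <oo) (low n)%:E <= (omega R d * (4 * b))%:E)%E.
  rewrite EFinM EFinM; apply: le_trans (lee_wpmul2l _ (sum_level_le b_gt0 _)).
  - rewrite -nneseriesZl; last first.
      by move=> n _; case: ifP => // _; rewrite lee_fin ltW.
    apply: le_series => n; first by rewrite lee_fin.
    by rewrite /low lee_fin; case: ifP => _; rewrite ?EFinM// mule0.
  - by rewrite lee_fin ltW.
  - by rewrite lee_fin ltW.
apply: (@le_trans _ _ (high_sum b rad r + (level_sum (d := d) b rad 1 +
    \sum_(n <oo) (low n)%:E))%E); last first.
  by rewrite leeD2l// EFinD LE leeD2l.
rewrite /high_sum /level_sum -nneseriesZl; last first.
  by move=> n _; rewrite lee_fin level_term_ge0// ltW.
rewrite -nneseriesD; last 2 first.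
- by move=> n _ _; rewrite lee_fin level_term_ge0.
- by move=> n _ _; rewrite lee_fin.
rewrite -nneseriesD; last 2 first.
- by move=> n _ _; rewrite lee_fin; case: ifP => // _; exact: term_ge0.
- by move=> n _ _; rewrite adde_ge0// lee_fin// level_term_ge0.
apply: le_series => n.
  by rewrite mule_ge0// lee_fin ?invr_ge0 ?(ltW r0)// level_term_ge0// ltW.
rewrite -EFinM -!EFinD lee_fin.
have t1 := level_term_ge0 b_gt0 rad_ge0 n (ler01 : 0 <= 1 :> R) (d := d).
have rE : Num.min r (rad n) = r * Num.min 1 (rad n / r).
  by rewrite minr_pMr ?(ltW r0)// mulr1 mulrCA divff ?gt_eqF// mulr1.
have -> : r^-1 * (level b n * (omega R d * rad n ^+ d * Num.min r (rad n))) =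
    level b n * (omega R d * rad n ^+ d * Num.min 1 (rad n / r)).
  by rewrite rE; field; rewrite gt_eqF.
have [bl|lb] := leP b (level b n).
  by rewrite lerDl addr_ge0.
rewrite add0r /low (ltW lb).
have rd0 : 0 <= rad n ^+ d by rewrite exprn_ge0.
apply: (@le_trans _ _ (level b n * (omega R d * rad n ^+ d))).
  rewrite ler_pM2l// ler_piMr ?mulr_ge0 ?(ltW w0)//.
  by rewrite ge_min lexx.
have [rad1|rad1] := leP 1 (rad n).
  by rewrite mulr1 lerDl mulr_ge0 ?(ltW w0)// ltW.
apply: ler_wpDl; first by rewrite !mulr_ge0// ?(ltW (l0 n)) ?(ltW w0).
rewrite mulrC -mulrA ler_pM2l// ler_piMl ?(ltW (l0 n))//.
by rewrite exprn_ile1// ltW.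
Qed.

(** By [level_inclusion], K dominates a weighted sum of indicators of N-balls of radius theta rad n.
    The threshold keeps these radii at most 1, as the translation argument requires. *)
Lemma interaction_high_sum : (forall y, (b%:E < K y)%E -> N y <= 1) ->
  exists A r0 : R, [/\ 0 < A, 0 < r0 & forall (E G : set 'rV[R]_d) r,
    measurable (G : set T) -> G `<=` Omega ->
    (forall x y, Omega x -> Omega y ->
      ((x \in E) != (y \in E)) = ((x \in G) != (y \in G))) ->
    0 < r <= r0 -> mu G = (omega R d * r ^+ d)%:E ->
    ((A * r ^+ d)%:E * high_sum b rad r <= interaction K E Omega Omega)%E].
Proof.
move=> bN.
have [v v0 vE] := unit_norm_ball d_gt0 K_kernel NN K_moment c0_gt0 K_dec.
have [c [r0 [c_gt0 r00 sep]]] := separated_lower_omega d_gt0 oO bO lO NN.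
(* Since theta <= 1 and d >= 1, theta^d v <= theta v <= omega / 2, strictly below omega. *)
pose theta := Num.min 1 (omega R d / (2 * v)).
have th0 : 0 < theta by rewrite lt_min ltr01 divr_gt0// mulr_gt0.
have th1 : theta <= 1 by rewrite ge_min lexx.
have thv : theta ^+ d * v < omega R d.
  have h1 : theta ^+ d <= theta.
    by rewrite -[leRHS]expr1 ler_wiXn2l// ltW.
  have h2 : theta * v <= omega R d / 2.
    rewrite -ler_pdivlMr// (_ : _ / v = omega R d / (2 * v)).
      by rewrite ge_min lexx orbT.
    by field; rewrite gt_eqF.
  apply: (@le_lt_trans _ _ (omega R d / 2)); last by rewrite ltr_pdivrMr// ltr_pMr// ltr1n.
  by apply: le_trans h2; rewrite ler_pM2r.
(* The factor c0 is lost to almost monotonicity, the factor 4 to the dyadic sum. *)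
pose l n := if b <= level b n then c0 / 4 * level b n else 0.
pose s n := if b <= level b n then theta * rad n else 0.
have inc n := level_inclusion NN c0_gt0 K_dec vE th0 thv (ltW (l0 n)) (rad_ge0 n) (radE n).
have l_ge0 n : 0 <= l n.
  by rewrite /l; case: ifP => // _; rewrite mulr_ge0// ?(ltW (l0 n))// divr_ge0// ltW.
have s01 n : 0 <= s n <= 1.
  rewrite /s; case: ifP => [bl|_]; last by rewrite lexx ler01.
  rewrite mulr_ge0 ?(ltW th0)//=; have [_] := inc n; apply => //.
  move=> y ly; apply: bN; apply: le_lt_trans ly; by rewrite lee_fin.
have lK z : (\sum_(n <oo) (l n)%:E * (\1_[set x | (N x < s n)%R] z)%:E <= K z)%E.
  have cK : (0 <= (c0^-1)%:E * K z)%E by rewrite mule_ge0// lee_fin invr_ge0 ltW.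
  have := sum_level_le b_gt0 cK.
  have c4 : (0 <= (c0 / 4)%:E :> \bar R)%E by rewrite lee_fin divr_ge0// ltW.
  move=> /(lee_wpmul2l c4); rewrite !muleA -!EFinM.
  have -> : c0 / 4 * 4 / c0 = 1 by field; rewrite gt_eqF.
  rewrite mul1e; apply: le_trans.
  rewrite -nneseriesZl; last first.
    by move=> n _; case: ifP => // _; rewrite lee_fin ltW.
  apply: le_series => n; first by rewrite mule_ge0// lee_fin.
  rewrite /l indicE; case: ifP => bl; last first.
    by rewrite mul0e mule_ge0//; case: ifP => // _; rewrite lee_fin ltW.
  case: (boolP (_ \in _)) => h; last first.
    by rewrite mule0 mule_ge0//; case: ifP => // _; rewrite lee_fin ltW.
  move: h; rewrite inE /= /s bl => zs; rewrite mule1 ifT ?EFinM//.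
  have [/(_ z zs) H _] := inc n.
  by rewrite lee_pdivlMl// -EFinM.
exists (c0 / 4 * (c * theta ^+ d * theta) / omega R d), r0; split => //.
  by rewrite divr_gt0// mulr_gt0 ?divr_gt0// !mulr_gt0// exprn_gt0.
move=> E G r mG GO EG rr0 GE; have /andP[r_gt0 _] := rr0.
have Goo : (mu G < +oo)%E by rewrite GE ltry.
have [F [bF FO FG]] :=
  interaction_ge_series K0 NN (borel_open oO) mG GO Goo EG l_ge0 lK.
apply: le_trans.
rewrite -nneseriesZl; last first.
  by move=> n _; rewrite lee_fin; case: ifP => // _; exact: term_ge0.
have A0 : 0 <= c0 / 4 * (c * theta ^+ d * theta) / omega R d * r ^+ d.
  rewrite mulr_ge0 ?exprn_ge0 ?(ltW r_gt0)// divr_ge0 ?(ltW w0)//.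
  by rewrite mulr_ge0 ?divr_ge0 ?(ltW c0_gt0)// !mulr_ge0 ?exprn_ge0 ?(ltW th0)// ltW.
apply: le_series => n.
  by rewrite mule_ge0// lee_fin//; case: ifP => // _; exact: term_ge0.
rewrite /l; case: ifP => bl; last by rewrite mule0 mul0e.
have FE : mu F = (omega R d * r ^+ d)%:E by rewrite FG.
have := sep F r (s n) bF FO rr0 FE (s01 n).
have cl : 0 <= c0 / 4 * level b n by rewrite mulr_ge0 ?divr_ge0 ?(ltW c0_gt0)// ltW.
have cl' : (0 <= (c0 / 4 * level b n)%:E :> \bar R)%E by rewrite lee_fin.
move=> /(lee_wpmul2l cl'); apply: le_trans.
rewrite -!EFinM lee_fin /s bl exprMn.
have m1 : theta * Num.min 1 (rad n / r) <= Num.min 1 (theta * rad n / r).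
  rewrite minr_pMr ?(ltW th0)// mulr1 mulrA le_min ge_min th1 /=.
  by rewrite ge_min lexx orbT.
rewrite [leLHS](_ : _ = c0 / 4 * level b n * (c * (r ^+ d *
  (theta ^+ d * rad n ^+ d * (theta * Num.min 1 (rad n / r)))))); last first.
  by field; rewrite gt_eqF.
rewrite (ler_wpM2l cl)// ler_pM2l// ler_pM2l ?exprn_gt0// ler_wpM2l//.
by rewrite mulr_ge0// exprn_ge0// ltW.
Qed.

End with_levels.

Lemma relative_isoperimetric_inequality : 0 < p ->
  exists2 C : R, 0 < C & forall E : set 'rV[R]_d, measurable (E : set T) ->
   (mine (mu (E `&` Omega)) (mu (Omega `\` E)) `^ p
         <= C%:E * perimeter_in K E Omega)%E.
Proof.
move=> p0.
have [b b0 bN] := ex_threshold d_gt0 K_kernel NN K_moment c0_gt0 K_dec.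
have [rad [rad0 radE]] := ex_level_radii d_gt0 K_kernel K_moment b0.
have [S S0 up] := iso_high_sum b0 rad0 radE.
have [A [r0 [A0 r00 lo]]] := interaction_high_sum b0 rad0 radE bN.
have [k k0 kK] := kernel_lower_bounded d_gt0 K_kernel NN K_moment c0_gt0 K_dec
  C1_gt0 K_iso bO.
have mO : measurable (Omega : set T) by apply: borel_measurable; exact: borel_open.
have [M M0 OM] := bounded_setP bO.
have Ooo : (mu Omega < +oo)%E.
  apply: (@le_lt_trans _ _ (mu (cube 0 (M + 1)))).
    apply: le_lebesgue_rV => x Ox i; rewrite mxE subr0.
    by rewrite (le_lt_trans (OM _ Ox i))// ltrDl.
  by rewrite lebesgue_rV_cube ?ltry// addr_gt0.
have Ofin : mu Omega \is a fin_num by rewrite ge0_fin_numE.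
pose V := fine (mu Omega).
have VE : mu Omega = V%:E by rewrite fineK.
have V0 : 0 <= V by exact: fine_ge0.
(* The larger of the two parts of [Omega] has measure at least V / 2, so the product of the two
   measures is at least m V / 2. *)
pose kap := k * V / 2.
have kap0 : 0 <= kap by rewrite divr_ge0// mulr_ge0// ltW.
have cd0 := @Cd_gt0 R d.
(* [D1] serves the high levels, [D2] the low ones and [D3] the sets with r > r0. If [Omega] is null
   then kap, [D2] and [D3] are 0 by the convention on division, which is harmless because m = 0. *)
pose D1 := C1 * Cd R d * omega R d / A.
pose D2 := C1 * Cd R d * S / kap.
pose D3 := V `^ p / (kap * (omega R d * r0 ^+ d)).
have D10 : 0 <= D1 by rewrite divr_ge0 ?(ltW A0)// !mulr_ge0// ltW.
have D20 : 0 <= D2 by rewrite divr_ge0// !mulr_ge0// ltW.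
have D30 : 0 <= D3.
  by rewrite divr_ge0 ?powR_ge0// mulr_ge0// mulr_ge0 ?exprn_ge0// ltW.
exists (2 * (D1 + D2 + D3 + 1)).
  by rewrite mulr_gt0// ltr_pwDr// !addr_ge0.
move=> E mE.
have I0 B : (0 <= interaction K E Omega B)%E.
  apply: integral_ge0 => x _; apply: integral_ge0 => y _.
  by rewrite mule_ge0// lee_fin.
set I := interaction K E Omega Omega.
suff main : (mine (mu (E `&` Omega)) (mu (Omega `\` E)) `^ p <=
    (D1 + D2 + D3)%:E * I)%E.
  apply: (le_trans main); rewrite /perimeter_in.
  apply: (@le_trans _ _ ((2 * (D1 + D2 + D3 + 1))%:E * (2^-1%:E * I))%E).
    rewrite muleA -EFinM lee_wpmul2r ?I0// lee_fin mulrAC divff// mul1r.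
    by rewrite lerDl.
  rewrite lee_wpmul2l//; first by rewrite lee_fin mulr_ge0// !addr_ge0.
  by rewrite leeDl.
pose a := fine (mu (E `&` Omega)); pose a' := fine (mu (Omega `\` E)).
have mA : measurable (E `&` Omega : set T) by exact: measurableI.
have mB : measurable (Omega `\` E : set T) by exact: measurableD.
have aE : mu (E `&` Omega) = a%:E.
  rewrite fineK// ge0_fin_numE//; apply: le_lt_trans Ooo.
  by apply: le_lebesgue_rV => x [].
have a'E : mu (Omega `\` E) = a'%:E.
  rewrite fineK// ge0_fin_numE//; apply: le_lt_trans Ooo.
  by apply: le_lebesgue_rV => x [].
have a0 : 0 <= a by exact: fine_ge0.
have a'0 : 0 <= a' by exact: fine_ge0.
have aV : V <= a + a'.
  rewrite -lee_fin EFinD -VE -aE -a'E.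
  apply: le_trans (lebesgue_rVU2 _ _); apply: le_lebesgue_rV => x Ox.
  by have [Ex|Ex] := pselect (E x); [left|right].
have aV' : a <= V by rewrite -lee_fin -VE -aE le_lebesgue_rV// => x [].
pose m := Num.min a a'.
have m0 : 0 <= m by rewrite le_min a0.
have mV : m <= V by rewrite ge_min aV'.
have Ilow : ((kap * m)%:E <= I)%E.
  apply: le_trans (interaction_ge_product K0 mO mE (ltW k0) kK).
  rewrite aE a'E -!EFinM lee_fin /kap -!mulrA ler_pM2l//.
  by rewrite /m; have [aa|aa] := leP a a'; nra.
(* [G] is the smaller of the two parts; complementation in [Omega] preserves the separated pairs. *)
have [G [mG GO EG GE]] : exists G : set 'rV[R]_d, [/\ measurable (G : set T),
    G `<=` Omega, (forall x y, Omega x -> Omega y ->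
      ((x \in E) != (y \in E)) = ((x \in G) != (y \in G))) & mu G = m%:E].
  have [aa|aa] := leP a a'.
    exists (E `&` Omega); split => //; last by rewrite aE /m min_l.
    by move=> x y Ox Oy; rewrite !in_setI (mem_set Ox) (mem_set Oy) !andbT.
  exists (Omega `\` E); split => //; last by rewrite a'E /m min_r// ltW.
  move=> x y Ox Oy; rewrite !in_setD (mem_set Ox) (mem_set Oy) !andTb.
  by case: (x \in E); case: (y \in E).
have -> : mine (mu (E `&` Omega)) (mu (Omega `\` E)) = m%:E.
  by rewrite aE a'E /m EFin_min.
rewrite poweR_EFin.
have [m_eq|m_neq] := eqVneq m 0.
  rewrite m_eq powR0; last by rewrite gt_eqF.
  by apply: mule_ge0; [rewrite lee_fin !addr_ge0|exact: I0].
have m_gt0 : 0 < m by rewrite lt_def m_neq.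
have V_gt0 : 0 < V by exact: lt_le_trans mV.
have kap_gt0 : 0 < kap by rewrite divr_gt0// mulr_gt0.
have [r r_ge0 rE] := ex_radius d_gt0 m0.
have r_gt0 : 0 < r.
  rewrite lt_def r_ge0 andbT; apply/eqP => r_eq.
  by move: rE; rewrite r_eq expr0n gtn_eqF// mulr0 => /esym/eqP; rewrite (negbTE m_neq).
(* For r > r0 the left side is at most V^p while m >= omega r0^d, so the product bound suffices. *)
have [rr0|r0r] := leP r r0.
  have rr : 0 < r <= r0 by rewrite r_gt0.
  have GE' : mu G = (omega R d * r ^+ d)%:E by rewrite rE.
  have lo1 := lo E G r mG GO EG rr GE'.
  have := up r r_gt0; rewrite rE => up1.
  have H0 := high_sum_ge0 b0 rad0 r_gt0.
  apply: (@le_trans _ _ ((D1 + D2)%:E * I)%E); last first.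
    by rewrite lee_wpmul2r ?I0// lee_fin lerDl.
  have -> : m `^ p = C1 * (m `^ p / C1) by field; rewrite gt_eqF.
  rewrite EFinM (le_trans (lee_wpmul2l _ up1)) ?lee_fin ?(ltW C1_gt0)//.
  rewrite muleA -EFinM ge0_muleDr// EFinD ge0_muleDl ?lee_fin//.
  apply: leeD.
    rewrite [X in (X%:E * _ <= _)%E](_ : _ = D1 * (A * r ^+ d)).
      by rewrite EFinM -muleA lee_wpmul2l// lee_fin.
    by rewrite /D1; field; rewrite gt_eqF.
  rewrite -EFinM (_ : _ * S = D2 * (kap * m)).
    by rewrite EFinM lee_wpmul2l// lee_fin.
  by rewrite /D2 -rE; field; rewrite gt_eqF.
apply: (@le_trans _ _ (D3%:E * I)%E); last first.
  by rewrite lee_wpmul2r ?I0// lee_fin lerDr addr_ge0.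
have rd0 : 0 < omega R d * r0 ^+ d by rewrite mulr_gt0// exprn_gt0.
apply: (@le_trans _ _ (D3%:E * (kap * m)%:E)%E); last first.
  by rewrite lee_wpmul2l// lee_fin.
rewrite -EFinM lee_fin /D3.
apply: (@le_trans _ _ (V `^ p)).
  by apply: ge0_ler_powR; rewrite ?nnegrE// ltW.
rewrite mulrAC ler_pdivlMr ?(mulr_gt0 kap_gt0 rd0)//.
rewrite ler_wpM2l ?powR_ge0// ler_pM2l// -rE ler_pM2l//.
by rewrite lerXn2r ?nnegrE// ltW.
Qed.

End relative_inequality.

Theorem corollary6p14 (R : realType) (d : nat) (hd : (1 <= d)%N)
    (Omega : set 'rV[R]_d)
    (Omega_open : open Omega) (Omega_bounded : bounded_set Omega)
    (Omega_lipschitz : lipschitz_boundary Omega)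
    (N : 'rV[R]_d -> R) (N_norm : is_norm N)
    (K : 'rV[R]_d -> \bar R) (K_kernel : is_kernel K)
    (K_not_L1 : ~ lebesgue_rV.-integrable [set: lebesgue_type R d] K)
    (K_almost_decreasing : exists2 c0 : R, 0 < c0 <= 1 &
       forall x y, N x <= N y -> (c0%:E * K y <= K x)%E)
    (K_doubling : exists D C_D : R, [/\ 0 < D, 0 < C_D &
       forall x y, N y = 2 * N x -> N x <= D -> (K x <= C_D%:E * K y)%E])
    (K_moment : (\int[lebesgue_rV]_z (K z * (Num.min 1%R (enorm z))%:E) < +oo)%E)
    (q : R) (q_ge1 : 1 <= q)
    (K_isoperimetric : exists2 C1 : R, 0 < C1 &
       forall m : R, 0 < m ->
         ((m `^ q^-1 / C1)%:E
            <= perimeter (rearrangement K) (ball_of_measure m))%E) :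
  exists2 C : R, 0 < C &
    forall E : set 'rV[R]_d, measurable (E : set (lebesgue_type R d)) ->
      (mine (lebesgue_rV (E `&` Omega)) (lebesgue_rV (Omega `\` E)) `^ q^-1
         <= C%:E * perimeter_in K E Omega)%E.
Proof.
have [c0 /andP[c0_gt0 _] K_dec] := K_almost_decreasing.
have [C1 C1_gt0 K_iso] := K_isoperimetric.
apply: (relative_isoperimetric_inequality hd K_kernel N_norm K_moment c0_gt0
  K_dec C1_gt0 K_iso Omega_open Omega_bounded Omega_lipschitz).
by rewrite invr_gt0 (lt_le_trans ltr01).
Qed.
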